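(* A finite simple graph $G$ has linear rankwidth at most $1$ if and only if none of the following three graphs is a vertex-minor of $G$: the $5$-cycle $C_5$; the net graph $N$; and the half-cube $Q$.
   Context: Graphs are finite, simple, undirected. For a graph $G$ and $X\subseteq V(G)$, $\operatorname{cutrk}_G(X)$ is the rank over $\mathrm{GF}(2)$ of the submatrix of the adjacency matrix of $G$ with rows indexed by $X$ and columns indexed by $V(G)\setminus X$. A linear rank decomposition of $G$ (with $|V(G)|\ge 2$) is a pair $(T,\lambda)$ where $T$ is a caterpillar (a tree containing a path such that every vertex is at distance at most $1$ from the path) with at least two vertices in which every non-leaf vertex has degree $3$, and $\lambda$ is a bijection from the leaves of $T$ to $V(G)$. Each edge $e$ of $T$ splits the leaves into $(X_e,Y_e)$; its width is $\operatorname{cutrk}_G(\lambda(X_e))$, and the width of $(T,\lambda)$ is the maximum width of its edges. The linear rankwidth of $G$ is the minimum width of a linear rank decomposition of $G$ (and $0$ if $|V(G)|\le 1$). The local complementation of $G$ at $v$ is the graph $G*v$ on $V(G)$ whose edge set is $E(G)$ symmetric-differenced with the set of all pairs of distinct vertices of $N_G(v)$. A graph $H$ is a vertex-minor of $G$ if $H$ can be obtained from $G$ by a sequence of local complementations and vertex deletions. The net graph $N$ is the graph on six vertices consisting of a triangle $x_1x_2x_3$ together with three further vertices $y_1,y_2,y_3$, where $y_i$ is adjacent only to $x_i$. The half-cube $Q$ is the graph on six vertices consisting of a $4$-cycle $p,q,r,s$ (edges $pq,qr,rs,sp$) together with two further vertices $a,b$, where $a$ is adjacent only to $q$ and $b$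 is adjacent only to $s$. *)

(* Defs.v *)
From mathcomp Require Import all_boot all_algebra.
From mathcomp Require Import boolp classical_sets.
Set Implicit Arguments.
Unset Strict Implicit.
Unset Printing Implicit Defensive.

Record sgraph := SGraph {
  svertex :> finType;
  sedge : rel svertex;
  sedge_sym : symmetric sedge;
  sedge_irr : irreflexive sedge }.

Notation "x -- y" := (sedge x y) (at level 30, no associativity).

Definition giso (G H : sgraph) : Prop :=
  exists2 f : G -> H, bijective f & forall x y, (f x -- f y) = (x -- y).

Section LocalComplementation.
Variables (G : sgraph) (v : G).

Definition lc_edge : rel G :=
  fun x y => (x -- y) (+) [&& x != y, v -- x & v -- y].

Lemma lc_edge_sym : symmetric lc_edge.
Proof.
by move=> x y; rewrite /lc_edge sedge_sym eq_sym [(v -- x) && _]andbC.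
Qed.

Lemma lc_edge_irr : irreflexive lc_edge.
Proof. by move=> x; rewrite /lc_edge sedge_irr eqxx. Qed.

Definition local_comp : sgraph := SGraph lc_edge_sym lc_edge_irr.
End LocalComplementation.

Section VertexDeletion.
Variables (G : sgraph) (v : G).

Definition del_edge : rel {x : G | x != v} := fun x y => val x -- val y.

Lemma del_edge_sym : symmetric del_edge.
Proof. by move=> x y; rewrite /del_edge sedge_sym. Qed.

Lemma del_edge_irr : irreflexive del_edge.
Proof. by move=> x; rewrite /del_edge sedge_irr. Qed.

Definition del_vertex : sgraph := SGraph del_edge_sym del_edge_irr.
End VertexDeletion.

(* [vertex_minor H G]: H is, up to isomorphism, obtained from G. *)
Inductive vertex_minor (H : sgraph) : sgraph -> Prop :=
| vm_iso (G : sgraph) : giso H G -> vertex_minor H G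
| vm_local_comp (G : sgraph) (v : G) :
    vertex_minor H (local_comp v) -> vertex_minor H G
| vm_del_vertex (G : sgraph) (v : G) :
    vertex_minor H (del_vertex v) -> vertex_minor H G.

Definition cutrk (G : sgraph) (X : {set G}) : nat :=
  \rank (\matrix_(i < #|X|, j < #|~: X|)
           ((enum_val i -- enum_val j)%:R : 'F_2))%R.

Definition is_tree (T : sgraph) : Prop :=
  [/\ 0 < #|T|,
      forall x y : T, connect (@sedge T) x y
    & forall c : seq T, 2 < size c -> ~ ucycle (@sedge T) c].

Definition caterpillar (T : sgraph) : Prop :=
  is_tree T /\
  exists (x : T) (p : seq T),
    [/\ path (@sedge T) x p, uniq (x :: p)
      & forall v : T, exists2 u, u \in x :: p & (u == v) || (u -- v)].

Definition degree (T : sgraph) (x : T) : nat := #|[set y | x -- y]|.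

Definition leaf (T : sgraph) (x : T) : bool := degree x == 1.

Record lin_rank_decomp (G : sgraph) := LinRankDecomp {
  ld_tree : sgraph;
  ld_caterpillar : caterpillar ld_tree;
  ld_card : 1 < #|ld_tree|;
  ld_degree : forall x : ld_tree, ~~ leaf x -> degree x = 3;
  ld_map : {x : ld_tree | leaf x} -> G;
  ld_bij : bijective ld_map }.

(* The leaves of T lying on the side of x once the edge xy is removed. *)
Definition leaf_side (T : sgraph) (x y : T) : {set {z : T | leaf z}} :=
  [set l | connect [rel u w | (u -- w) && ([set u; w] != [set x; y])]
                   x (val l)].

(* Each edge is visited in both orientations, that is, both of its sides are
   taken into account; these have the same cut-rank. *)
Definition ld_width (G : sgraph) (D : lin_rank_decomp G) : nat :=
  \max_(e : ld_tree D * ld_tree D | e.1 -- e.2)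
     cutrk [set ld_map l | l in leaf_side e.1 e.2].

(* Every graph with at least two vertices has a linear rank decomposition, so
   the default value #|G| (an upper bound on all widths) is never used. *)
Definition linear_rankwidth (G : sgraph) : nat :=
  if #|G| <= 1 then 0 else
  xget #|G| (fun k : nat =>
    (exists D : lin_rank_decomp G, ld_width D = k) /\
    (forall D : lin_rank_decomp G, k <= ld_width D)).

Section EdgeListGraph.
Variables (n : nat) (s : seq (nat * nat)).

Definition el_edge : rel 'I_n := fun i j =>
  (i != j) && (((i : nat, j : nat) \in s) || ((j : nat, i : nat) \in s)).

Lemma el_edge_sym : symmetric el_edge.
Proof. by move=> i j; rewrite /el_edge eq_sym orbC. Qed.

Lemma el_edge_irr : irreflexive el_edge.
Proof. by move=> i; rewrite /el_edge eqxx. Qed.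

Definition edge_list_graph : sgraph := SGraph el_edge_sym el_edge_irr.
End EdgeListGraph.

Definition C5 : sgraph :=
  edge_list_graph 5 [:: (0, 1); (1, 2); (2, 3); (3, 4); (4, 0)].

(* x1, x2, x3, y1, y2, y3 are numbered 0, ..., 5. *)
Definition net : sgraph :=
  edge_list_graph 6 [:: (0, 1); (1, 2); (2, 0); (0, 3); (1, 4); (2, 5)].

(* p, q, r, s, a, b are numbered 0, ..., 5. *)
Definition half_cube : sgraph :=
  edge_list_graph 6 [:: (0, 1); (1, 2); (2, 3); (3, 0); (4, 1); (5, 3)].

(* Main.v *)
Require Import Defs.
From mathcomp Require Import all_boot all_algebra.
From mathcomp Require Import boolp zify.
From mathcomp Require classical_sets.
Set Implicit Arguments.
Unset Strict Implicit.
Unset Printing Implicit Defensive.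

(** A set [X] of vertices has cut-rank at most 1 iff all 2x2 minors between [X]
and its complement vanish (the cut is [thin]); this is preserved by local
complementation.  A linear rank decomposition of width at most 1 amounts to a
layout, i.e. an ordering of the vertices all of whose initial segments are thin.

None of the three graphs has a layout: no 2-set of [C5] and no 3-set of the net
or the half-cube is thin.  Conversely, suppose [G] has none of them as a
vertex-minor; a layout is found by induction on the number of vertices.  One may
assume [G] connected.

If some pair {v, w} is thin, insert v into a layout P, w, S of G - v.  The three
parts P, S, {v, w} have thin cuts, and after a local complementation they are
pairwise joined by edges.  If one of them is a clique of vertices with outside
neighbours, it can be placed between the other two.  Otherwise each part
contains two false twins or a pendant edge, and these six vertices induce a
graph locally equivalent to the net or the half-cube.

If no pair is thin, take v with K = G - v connected.  The two ends of a layout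
of K are disjoint thin pairs of K, and local complementation in K turns them
into two leaves, which must be adjacent to v and have distinct neighbours.
Shortening the path between these leaves by local complementations then yields
a 5-cycle through v. *)

(** * Local complementation and thin cuts *)

Section Relations.
Variable T : eqType.
Implicit Types (e : rel T) (P Q : mem_pred T) (s t : seq T).

Definition graph_rel e := symmetric e /\ irreflexive e.

Definition lc e v : rel T := fun x y => e x y (+) [&& x != y, e v x & e v y].

Definition lcs e s : rel T := foldl lc e s.

Lemma graph_lc e v : graph_rel e -> graph_rel (lc e v).
Proof.
move=> [es ei]; split=> [x y|x]; rewrite /lc; last by rewrite ei eqxx.
by rewrite es eq_sym [e v x && _]andbC.
Qed.

Lemma graph_lcs e s : graph_rel e -> graph_rel (lcs e s).
Proof. by elim: s e => //= v s IH e /(graph_lc v); apply: IH. Qed.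

Lemma lcK e v : graph_rel e -> lc (lc e v) v = e.
Proof.
move=> [es ei]; apply/funext => x; apply/funext => y.
rewrite /lc ei /= !andbF !addbF.
by case: (e x y); case: (x != y); case: (e v x); case: (e v y).
Qed.

Lemma lcs_cat e s t : lcs e (s ++ t) = lcs (lcs e s) t.
Proof. by rewrite /lcs foldl_cat. Qed.

(** Over GF(2) a product of entries is a conjunction, so the equation is a vanishing 2x2 minor.
    Arguments of type [mem_pred] let sequences, sets and predicates be used alike. *)
Definition thin_mem e (P Q : mem_pred T) := forall p p' q q',
  in_mem p P -> in_mem p' P -> in_mem q Q -> in_mem q' Q ->
  e p q && e p' q' = e p q' && e p' q.

Lemma thinC e P Q : graph_rel e -> thin_mem e P Q -> thin_mem e Q P.
Proof.
move=> [es _] h p p' q q' hp hp' hq hq'.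
by rewrite !(es p) !(es p') h // andbC.
Qed.

Lemma thinS e P Q P' Q' :
  (forall x, in_mem x P' -> in_mem x P) ->
  (forall x, in_mem x Q' -> in_mem x Q) -> thin_mem e P Q -> thin_mem e P' Q'.
Proof. by move=> sP sQ h p p' q q' /sP ? /sP ? /sQ ? /sQ ?; apply: h. Qed.

Lemma thin1 e P Q x : (forall y, in_mem y P -> y = x) -> thin_mem e P Q.
Proof. by move=> h p p' q q' /h-> /h-> _ _; rewrite andbC. Qed.

(** For [v] in [P], complementing at [v] adds the row of [v] to the row of each neighbour of [v] in
    [P]: a row operation. The case of [v] in [Q] is its transpose. *)
Lemma thin_lc e P Q v : graph_rel e -> in_mem v P || in_mem v Q ->
  (forall x y, in_mem x P -> in_mem y Q -> x != y) ->
  thin_mem e P Q -> thin_mem (lc e v) P Q.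
Proof.
move=> ge; have [es _] := ge.
have main P' Q' : in_mem v P' ->
    (forall x y, in_mem x P' -> in_mem y Q' -> x != y) ->
    thin_mem e P' Q' -> thin_mem (lc e v) P' Q'.
  move=> vP dis h p p' q q' hp hp' hq hq'; rewrite /lc !dis //=.
  (* By bilinearity the new minor on rows [p], [p'] is a combination of the old ones on [p], [p'],
     on [v], [p'] and on [p], [v]. *)
  move: (h p p' q q' hp hp' hq hq') (h v p' q q' vP hp' hq hq').
  move: (h p v q q' hp vP hq hq').
  case: (e p q); case: (e p' q'); case: (e p q'); case: (e p' q);
  case: (e v p); case: (e v p'); case: (e v q); case: (e v q') => //=.
case/orP=> [vP dis h|vQ dis h]; first exact: main.
apply: (thinC (graph_lc v ge)); apply: main => //; last exact: thinC.
by move=> x y hx hy; rewrite eq_sym dis.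
Qed.

End Relations.

Notation thin e P Q := (thin_mem e (mem P) (mem Q)).

Section Layouts.
Variable T : finType.
Implicit Types (e : rel T) (A X : {set T}) (s t : seq T).

Definition layout e A := exists s,
  [/\ uniq s, s =i A & forall s1 s2, s = s1 ++ s2 -> thin e s1 s2].

Lemma uniq_cat_neq s1 s2 :
  uniq (s1 ++ s2) -> {in s1 & s2, forall x y, x != y}.
Proof.
rewrite cat_uniq => /and3P[_ /hasPn h _] x y hx hy.
by apply/eqP=> exy; move: (h y hy); rewrite /= -exy hx.
Qed.

Lemma layout_lc e A v : graph_rel e -> v \in A ->
  layout e A -> layout (lc e v) A.
Proof.
move=> ge vA [s [us sA h]]; exists s; split=> // s1 s2 es.
apply: thin_lc => //; last exact: h.
  by rewrite -mem_cat -es sA.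
by apply: uniq_cat_neq; rewrite -es.
Qed.

Lemma layout_lcV e A v : graph_rel e -> v \in A ->
  layout (lc e v) A -> layout e A.
Proof.
by move=> ge vA /(layout_lc (graph_lc v ge) vA); rewrite lcK.
Qed.

Lemma thin_lcs e X A s : graph_rel e -> {subset s <= A} -> X \subset A ->
  thin e X (A :\: X) -> thin (lcs e s) X (A :\: X).
Proof.
elim: s e => //= v s IH e ge sA XA h.
apply: IH => //; first exact: graph_lc.
  by move=> x hx; apply: sA; rewrite inE hx orbT.
apply: thin_lc => //.
  by rewrite inE (sA v (mem_head _ _)) andbT; case: (v \in X).
by move=> x y xX; rewrite inE => /andP[yX _]; apply: contraNneq yX => <-.
Qed.

Lemma thin_lcsV e X A s : graph_rel e -> {subset s <= A} -> X \subset A ->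
  thin (lcs e s) X (A :\: X) -> thin e X (A :\: X).
Proof.
elim: s e => //= v s IH e ge sA XA h.
have {}h : thin (lc e v) X (A :\: X).
  apply: IH h => //; first exact: graph_lc.
  by move=> x hx; apply: sA; rewrite inE hx orbT.
rewrite -(lcK v ge); apply: thin_lc => //; first exact: graph_lc.
  by rewrite inE (sA v (mem_head _ _)) andbT; case: (v \in X).
by move=> x y xX; rewrite inE => /andP[yX _]; apply: contraNneq yX => <-.
Qed.

Definition conn e A := forall X, X \subset A -> X != set0 -> X != A ->
  exists x y, [/\ x \in X, y \in A :\: X & e x y].

(** Complementing at [v] keeps the edges at [v]. If no edge crosses a cut afterwards, then [v] had
    no neighbour across it before, so nothing across the cut has changed. *)
Lemma conn_lc e A v : graph_rel e -> v \in A -> conn e A -> conn (lc e v) A.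
Proof.
move=> [es ei] vA h X XA X0 XnA; apply: contrapT => nh.
have no x y : x \in X -> y \in A :\: X -> lc e v x y = false.
  by move=> hx hy; apply/negP => exy; apply: nh; exists x, y.
have [x [y [xX yX exy]]] := h X XA X0 XnA.
have dis a b : a \in X -> b \in A :\: X -> a != b.
  by move=> aX; rewrite inE => /andP[bX _]; apply: contraNneq bX => <-.
have no' a b (aX : a \in X) (bX : b \in A :\: X) := no a b aX bX.
case: (boolP (v \in X)) => vX.
  move: (no v y vX yX) (no x y xX yX); rewrite /lc ei /= andbF addbF => vy.
  by rewrite exy vy !andbF.
have vD : v \in A :\: X by rewrite inE vX.
move: (no x v xX vD) (no x y xX yX); rewrite /lc ei !andbF addbF => xv.
by rewrite exy (es v x) xv andbF.
Qed.

Lemma conn_lcs e A s : graph_rel e -> {subset s <= A} -> conn e A ->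
  conn (lcs e s) A.
Proof.
elim: s e => //= v s IH e ge sA h; apply: IH.
- exact: graph_lc.
- by move=> x hx; apply: sA; rewrite inE hx orbT.
- by apply: conn_lc => //; apply: sA; rewrite mem_head.
Qed.

End Layouts.

(** * Obstructions and tripartitions *)

Definition pattern (l : seq (nat * nat)) : rel nat :=
  fun i j => (i != j) && (((i, j) \in l) || ((j, i) \in l)).

Definition C5_edges := [:: (0, 1); (1, 2); (2, 3); (3, 4); (4, 0)].
Definition net_edges := [:: (0, 1); (1, 2); (2, 0); (0, 3); (1, 4); (2, 5)].
Definition half_cube_edges :=
  [:: (0, 1); (1, 2); (2, 3); (3, 0); (4, 1); (5, 3)].

Section Obstructions.
Variable T : finType.
Implicit Types (e : rel T) (A X : {set T}) (s t : seq T).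

(** Deletions can be postponed past local complementations: [t] acts on the whole vertex type, and
    restricting to the image of [f] does all deletions at once. *)
Definition has_pattern n l e := exists t (f : nat -> T),
  {in gtn n &, injective f} /\
  forall i j, i < n -> j < n -> lcs e t (f i) (f j) = pattern l i j.

Definition obstructed e := [\/ has_pattern 5 C5_edges e,
  has_pattern 6 net_edges e | has_pattern 6 half_cube_edges e].

Lemma obstructed_lcs e s : obstructed (lcs e s) -> obstructed e.
Proof.
have h n l : has_pattern n l (lcs e s) -> has_pattern n l e.
  by move=> [t [f [fi h]]]; exists (s ++ t), f; rewrite lcs_cat.
by case=> [/h|/h|/h]; [constructor 1|constructor 2|constructor 3].
Qed.

Lemma lcs_map n (f : nat -> T) e (h : rel nat) (t : seq nat) :
  {in gtn n &, injective f} -> all (gtn n) t ->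
  (forall i j, i < n -> j < n -> e (f i) (f j) = h i j) ->
  forall i j, i < n -> j < n -> lcs e (map f t) (f i) (f j) = lcs h t i j.
Proof.
move=> fi; elim: t e h => [|v t IH] e h //= /andP[vn tn] eh i j ilt jlt.
apply: IH => // {ilt jlt} {}i {}j ilt jlt.
by rewrite /lc !eh // (inj_in_eq fi).
Qed.

(** A certificate to be checked by computation: [t] lists where to complement, and entry [i] of [r]
    is the vertex that plays the role of [i] in the pattern. *)
Definition find_pattern n l (h : rel nat) (t r : seq nat) :=
  [&& all (gtn n) t, size r == n, uniq r, all (gtn n) r &
    all (fun i => all (fun j =>
      lcs h t (nth 0 r i) (nth 0 r j) == pattern l i j) (iota 0 n)) (iota 0 n)].

Lemma has_pattern_seq n l e (h : rel nat) (t r : seq nat) (x0 : T) xs :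
  graph_rel e -> uniq xs -> size xs = n ->
  (forall i, i < n -> h i i = false) ->
  (forall i j, i < n -> j < n -> h i j = h j i) ->
  (forall i j, i < j -> j < n -> e (nth x0 xs i) (nth x0 xs j) = h i j) ->
  find_pattern n l h t r -> has_pattern n l e.
Proof.
move=> [es ei] uxs sxs hi hs eh /and5P[tn /eqP sr ur rn /allP hp].
set f := nth x0 xs.
have fi : {in gtn n &, injective f}.
  by move=> i j; rewrite !inE -sxs => ilt jlt /eqP; rewrite nth_uniq // => /eqP.
have rlt i : i < n -> nth 0 r i < n.
  by move=> ilt; have /allP/(_ (nth 0 r i)) := rn; apply; rewrite mem_nth ?sr.
have ef i j : i < n -> j < n -> e (f i) (f j) = h i j.
  case: (ltngtP i j) => [ij _ jn|ji iN _|-> jn _].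
  - exact: eh.
  - by rewrite es hs //; [exact: eh | exact: ltn_trans iN].
  - by rewrite ei hi.
exists (map f t), (fun i => f (nth 0 r i)); split.
  move=> i j; rewrite !inE => ilt jlt /fi; rewrite !inE => /(_ (rlt _ ilt) (rlt _ jlt)).
  by move/eqP; rewrite nth_uniq ?sr // => /eqP.
move=> i j ilt jlt; rewrite (lcs_map fi tn ef) ?rlt //.
have := hp i; rewrite mem_iota => /(_ ilt) /allP/(_ j).
rewrite mem_iota => /(_ jlt).
by move/eqP.
Qed.

(** Such an [s] runs from an outer end towards a centre where it will meet other chains. The case of
    empty [s2] says that the whole of [s] is thin against the rest of [A]. *)
Definition chain e A s := forall s1 s2, s = s1 ++ s2 ->
  thin e [set x in s1] (A :\: [set x in s1]).

Lemma chain_lc e A s v : graph_rel e -> v \in A -> {subset s <= A} ->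
  chain e A s -> chain (lc e v) A s.
Proof.
move=> ge vA sA h s1 s2 es; have {}h := h s1 s2 es.
apply: (@thin_lcs _ e _ A [:: v]) => //.
  by move=> x; rewrite inE => /eqP->.
by apply/subsetP => x; rewrite inE => hx; apply: sA; rewrite es mem_cat hx.
Qed.

Lemma chain_cut e A s1 s2 : uniq (s1 ++ s2) -> {subset s2 <= A} ->
  thin e [set x in s1] (A :\: [set x in s1]) -> thin e s1 s2.
Proof.
move=> us s2A; apply: thinS => x /= hx; first by rewrite inE.
rewrite !inE (s2A _ hx) andbT; apply/negP => hx1.
by move: (uniq_cat_neq us hx1 hx); rewrite eqxx.
Qed.

Lemma cat_eq_cat s1 s2 t1 t2 : s1 ++ s2 = t1 ++ t2 ->
  (exists2 k, t1 = s1 ++ k & s2 = k ++ t2) \/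
  (exists2 k, s1 = t1 ++ k & t2 = k ++ s2).
Proof.
elim: s1 t1 => [|x s1 IH] [|y t1] /=.
- by move=> ->; left; exists [::].
- by move=> ->; left; exists (y :: t1).
- by move=> <-; right; exists (x :: s1).
- case=> -> /IH[[k -> ->]|[k -> ->]]; [left|right]; by exists k.
Qed.

Section Tripartition.
Variables (e : rel T) (A : {set T}).
Hypothesis ge : graph_rel e.

Definition tripartition e s1 s2 s3 :=
  [/\ uniq (s1 ++ s2 ++ s3), s1 ++ s2 ++ s3 =i A,
      chain e A s1, chain e A s2 & chain e A s3].

Lemma tri_rot s1 s2 s3 :
  tripartition e s1 s2 s3 -> tripartition e s2 s3 s1.
Proof.
case=> u m c1 c2 c3; split=> //.
  by rewrite catA uniq_catC.
by move=> x; rewrite -m !mem_cat orbA orbC.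
Qed.

(** Go inwards along [s2], across [s1] and outwards along [s3]. A cut inside [s2] or [s3] is thin by
    its chain; the cuts inside [s1] are left to the hypothesis. *)
Lemma tri_layout s1 s2 s3 : tripartition e s1 s2 s3 ->
  (forall k k', s1 = k ++ k' -> thin e (s2 ++ k) (k' ++ rev s3)) ->
  layout e A.
Proof.
case=> u m c1 c2 c3 mid; exists (s2 ++ s1 ++ rev s3).
have u' : uniq (s2 ++ s1 ++ rev s3).
  rewrite -(perm_uniq (s1 := s1 ++ s2 ++ s3)) // perm_catCA.
  by rewrite perm_cat2l perm_cat2l perm_sym perm_rev.
have m' : s2 ++ s1 ++ rev s3 =i A.
  by move=> x; rewrite -m !mem_cat mem_rev orbCA.
split=> // t1 t2 et; have u2 := u'; have m2 := m'; rewrite et in u2 m2.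
have t2A : {subset t2 <= A} by move=> x hx; rewrite -m2 mem_cat hx orbT.
have t1A : {subset t1 <= A} by move=> x hx; rewrite -m2 mem_cat hx.
case: (cat_eq_cat (esym et)) => [[k e2 _]|[k et1 e13]].
  by apply: (chain_cut u2 t2A); apply: c2 e2.
case: (cat_eq_cat e13) => [[k' ek er]|[k' ek er]]; last first.
  rewrite et1 er; exact: mid.
have e3 : s3 = rev t2 ++ rev k' by rewrite -rev_cat -er revK.
have h := c3 _ _ e3; apply: thinC => //.
have ut : uniq (rev t2 ++ t1).
  by rewrite -(perm_uniq (s1 := t1 ++ t2)) // perm_catC perm_cat2r perm_sym perm_rev.
by apply: thinS (chain_cut ut t1A h) => x //=; rewrite mem_rev.
Qed.

Lemma tri_layout0 s2 s3 : tripartition e [::] s2 s3 -> layout e A.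
Proof.
move=> tri; apply: (tri_layout tri) => -[|//] [|//] _; rewrite cats0 /=.
case: tri => /= u m _ c2 _; apply: chain_cut (c2 s2 [::] (esym (cats0 _))).
  rewrite -(perm_uniq (s1 := s2 ++ s3)) // perm_cat2l perm_sym.
  by rewrite perm_rev.
by move=> x; rewrite mem_rev -m mem_cat => ->; rewrite orbT.
Qed.

Lemma tri_disjoint s1 s2 s3 x : tripartition e s1 s2 s3 ->
  x \in s1 -> (x \in s2 ++ s3) = false.
Proof.
case=> u _ _ _ _ x1; apply/negP => x2.
by have := uniq_cat_neq u x1 x2; rewrite eqxx.
Qed.

Lemma tri_thin s1 s2 s3 : tripartition e s1 s2 s3 -> thin e s1 (s2 ++ s3).
Proof.
case=> u m c1 _ _; apply: (chain_cut u) (c1 s1 [::] (esym (cats0 _))).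
by move=> x hx; rewrite -m mem_cat hx orbT.
Qed.

Section Triangle.
Variables (s1 s2 s3 : seq T) (a b c : T).
Hypotheses (tri : tripartition e s1 s2 s3) (cA : conn e A).
Hypotheses (a1 : a \in s1) (b2 : b \in s2) (c3 : c \in s3).
Hypotheses (ab : e a b) (bc : e b c) (ca : e c a).

(** The minor with rows [x], [a] and columns [y], [b] vanishes, and its entry at [a], [b] is 1. *)
Lemma tri_cross12 x y : x \in s1 -> y \in s2 -> e x y = e x b && e y a.
Proof.
move=> x1 y2; have [es _] := ge.
have := tri_thin tri x1 a1 (_ : y \in s2 ++ s3) (_ : b \in s2 ++ s3).
by rewrite !mem_cat y2 b2 ab andbT (es y a) => /(_ isT isT) ->.
Qed.

Lemma tri_cross13 x z : x \in s1 -> z \in s3 -> e x z = e x c && e z a.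
Proof.
move=> x1 z3; have [es _] := ge.
have := tri_thin tri x1 a1 (_ : z \in s2 ++ s3) (_ : c \in s2 ++ s3).
by rewrite !mem_cat z3 c3 !orbT (es a c) ca andbT (es z a) => /(_ isT isT) ->.
Qed.

(** A vertex of [s1] adjacent to [b], equivalently to [c], is called active below; by the two
    product formulas these are the vertices of [s1] with neighbours outside [s1]. *)
Lemma tri_active x : x \in s1 -> e x b = e x c.
Proof.
move=> x1; rewrite (tri_cross13 x1 c3) ca andbT.
have [es _] := ge.
have := tri_thin tri x1 a1 (_ : b \in s2 ++ s3) (_ : c \in s2 ++ s3).
by rewrite !mem_cat b2 c3 !orbT (es a c) ca ab !andbT => /(_ isT isT) ->.
Qed.

End Triangle.

Section Clique.
Variables (s1 s2 s3 : seq T) (a b c : T).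
Hypotheses (tri : tripartition e s1 s2 s3) (cA : conn e A).
Hypotheses (a1 : a \in s1) (b2 : b \in s2) (c3 : c \in s3).
Hypotheses (ab : e a b) (bc : e b c) (ca : e c a).

(** Every cut inside [s1] is an outer product: a clique vertex is adjacent to all clique vertices
    and all active vertices across the cut, and a vertex of [s2] or [s3] is active exactly when it
    is adjacent to [a]. *)
Lemma tri_clique : {in s1, forall x, e x b} ->
  {in s1 &, forall x y, x != y -> e x y} -> layout e A.
Proof.
move=> act clq; have [es _] := ge; apply: (tri_layout tri) => k k' ek.
have tri2 := tri_rot tri; have tri3 := tri_rot tri2.
have u : uniq (k ++ k') by case: tri => + _ _ _ _; rewrite cat_uniq ek => /and3P[].
pose al p := (p \in k) || e p a.
pose be q := (q \in k') || e q a.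
suff prod p q : p \in s2 ++ k -> q \in k' ++ rev s3 -> e p q = al p && be q.
  move=> p p' q q' /= hp hp' hq hq'; rewrite !prod //.
  by case: (al p); case: (al p'); case: (be q); case: (be q').
have ks x : x \in k -> x \in s1 by rewrite ek mem_cat => ->.
have ks' x : x \in k' -> x \in s1 by rewrite ek mem_cat orbC => ->.
rewrite !mem_cat mem_rev /al /be => hp hq.
case/orP: hp => hp; case/orP: hq => hq.
- rewrite hq /= andbT.
  have -> : p \in k = false.
    apply/negP => /ks pk; have := tri_disjoint tri pk; by rewrite mem_cat hp.
  by rewrite es (tri_cross12 tri a1 b2 ab) ?(ks' _ hq) // act // ks'.
- have -> : p \in k = false.
    apply/negP => /ks pk; have := tri_disjoint tri pk; by rewrite mem_cat hp.
  have -> : q \in k' = false.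
    by apply/negP => /ks' pk; have := tri_disjoint tri pk; rewrite mem_cat hq orbT.
  rewrite (tri_cross12 tri2 b2 c3 bc hp hq) /=.
  rewrite (tri_active tri2 b2 c3 a1 bc ab hp).
  by rewrite (tri_active tri3 c3 a1 b2 ca bc hq).
- rewrite hp hq clq //; [exact: ks|exact: ks'|exact: uniq_cat_neq u _ _ hp hq].
- rewrite hp /=; have -> : q \in k' = false.
    by apply/negP => /ks' pk; have := tri_disjoint tri pk; rewrite mem_cat hq orbT.
  have p1 := ks _ hp.
  rewrite (tri_cross13 tri a1 c3 ca p1 hq) -(tri_active tri a1 b2 c3 ab ca p1).
  by rewrite act.
Qed.

(** The equation covers two cases. If [y] is active too, then [x] and [y] are nonadjacent, false
    twins as seen from the other parts; if not, [x] and [y] form an edge whose end [y] has no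
    neighbour in the other parts. *)
Lemma tri_witness : layout e A \/
  exists x y, [/\ x \in s1, y \in s1, x != y, e x b & e x y = ~~ e y b].
Proof.
have [es ei] := ge.
have [/allP act|/allPn[x0 x01 x0b]] := boolP (all (fun x => e x b) s1).
  have [/allP clq|/allPn[x x1 /allPn[y y1]]] :=
    boolP (all (fun x => all (fun y => (x == y) || e x y) s1) s1).
    left; apply: tri_clique => // x y x1 y1 /negbTE xy.
    by have /allP/(_ y y1) := clq x x1; rewrite xy.
  rewrite negb_or => /andP[xy exy]; right; exists x, y.
  by split=> //; [exact: act | rewrite (act _ y1) (negbTE exy)].
right.
have m : s1 ++ s2 ++ s3 =i A by case: tri.
(* By connectivity an edge leaves the set of inactive vertices of [s1]. It cannot leave [s1], so it
   ends at an active vertex of [s1]. *)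
pose X := [set x | (x \in s1) && ~~ e x b].
have [] := cA (X := X).
- by apply/subsetP => x; rewrite inE -m mem_cat => /andP[->].
- by apply/set0Pn; exists x0; rewrite inE x01.
- apply/eqP => /setP/(_ a); rewrite inE ab andbF -m mem_cat a1 //.
move=> x [y [+ + exy]]; rewrite !inE => /andP[x1 xb]; rewrite -m !mem_cat.
have xc : e x c = false.
  by rewrite -(tri_active tri a1 b2 c3 ab ca x1) (negbTE xb).
case/andP=> nX /orP[y1|/orP[y2|y3]].
- move: nX; rewrite y1 /= negbK => yb; exists y, x; split=> //.
    by apply: contraNneq xb => <-.
  by rewrite es exy xb.
- by move: exy; rewrite (tri_cross12 tri a1 b2 ab x1 y2) (negbTE xb).
- by move: exy; rewrite (tri_cross13 tri a1 c3 ca x1 y3) xc.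
Qed.

End Clique.
End Tripartition.
End Obstructions.

Section TripartitionTheorem.
Variables (T : finType) (A : {set T}).
Implicit Types (e : rel T) (s : seq T).

(* Three mutually adjacent vertices 0, 1, 2; the vertex [i + 3] is a false twin
   of [i] when the [i]-th boolean of [act] is true, and pendant at [i] otherwise. *)
Definition doubled_triangle (act : seq bool) : rel nat := fun i j =>
  let active k := (k < 3) || nth false act (k - 3) in
  if i %% 3 == j %% 3 then (i != j) && ~~ nth false act (i %% 3)
  else active i && active j.

(** Adjacency between parts is a product of activities, so the graph induced on the six witnesses
    depends only on which of [x2], [y2], [z2] are active. *)
Lemma tri_core e s1 s2 s3 a b c : graph_rel e ->
  tripartition A e s1 s2 s3 -> conn e A ->
  a \in s1 -> b \in s2 -> c \in s3 -> e a b -> e b c -> e c a ->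
  layout e A \/ obstructed e.
Proof.
move=> ge tri cA a1 b2 c3 ab bc ca; have [es ei] := ge.
have tri2 := tri_rot tri; have tri3 := tri_rot tri2.
have [|[x1 [x2 [x11 x21 nx x1b ex]]]] := tri_witness ge tri cA a1 b2 c3 ab bc ca.
  by left.
have [|[y1 [y2 [y11 y21 ny y1b ey]]]] := tri_witness ge tri2 cA b2 c3 a1 bc ca ab.
  by left.
have [|[z1 [z2 [z11 z21 nz z1b ez]]]] := tri_witness ge tri3 cA c3 a1 b2 ca ab bc.
  by left.
right.
have E12 := tri_cross12 ge tri a1 b2 ab.
have E23 := tri_cross12 ge tri2 b2 c3 bc.
have E31 := tri_cross12 ge tri3 c3 a1 ca.
have A1 := tri_active ge tri a1 b2 c3 ab ca.
have A2 := tri_active ge tri2 b2 c3 a1 bc ab.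
have A3 := tri_active ge tri3 c3 a1 b2 ca bc.
have E13 x z : x \in s1 -> z \in s3 -> e x z = e x b && e z a.
  by move=> hx hz; rewrite es E31 // -A1 // andbC.
have {}E12 x y : x \in s1 -> y \in s2 -> e x y = e x b && e y c.
  by move=> hx hy; rewrite E12 // -A2.
have {}E23 y z : y \in s2 -> z \in s3 -> e y z = e y c && e z a.
  by move=> hy hz; rewrite E23 // -A3.
set xs := [:: x1; y1; z1; x2; y2; z2].
have D12 x y : x \in s1 -> y \in s2 -> x == y = false.
  move=> hx hy; apply/eqP => exy; have := tri_disjoint tri hx.
  by rewrite mem_cat exy hy.
have D13 x y : x \in s1 -> y \in s3 -> x == y = false.
  move=> hx hy; apply/eqP => exy; have := tri_disjoint tri hx.
  by rewrite mem_cat exy hy orbT.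
have D23 x y : x \in s2 -> y \in s3 -> x == y = false.
  move=> hx hy; apply/eqP => exy; have := tri_disjoint tri2 hx.
  by rewrite mem_cat exy hy.
have uxs : uniq xs.
  have D21 x y : x \in s2 -> y \in s1 -> x == y = false.
    by move=> hx hy; rewrite eq_sym D12.
  have D31 x y : x \in s3 -> y \in s1 -> x == y = false.
    by move=> hx hy; rewrite eq_sym D13.
  have D32 x y : x \in s3 -> y \in s2 -> x == y = false.
    by move=> hx hy; rewrite eq_sym D23.
  rewrite /= !inE (D12 x1 y1) // (D13 x1 z1) // (D12 x1 y2) // (D13 x1 z2) //.
  rewrite (D23 y1 z1) // (D21 y1 x2) // (D23 y1 z2) // (D31 z1 x2) //.
  rewrite (D32 z1 y2) // (D12 x2 y2) // (D13 x2 z2) // (D23 y2 z2) //.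
  by rewrite (negbTE nx) (negbTE ny) (negbTE nz).
set h := doubled_triangle [:: e x2 b; e y2 c; e z2 a].
have hi i : i < 6 -> h i i = false.
  by rewrite /h /doubled_triangle !eqxx.
have hs i j : i < 6 -> j < 6 -> h i j = h j i.
  rewrite /h /doubled_triangle [j %% 3 == _]eq_sym [j == i]eq_sym => _ _.
  by case: eqP => [->|_] //; rewrite andbC.
have eh i j : i < j -> j < 6 -> e (nth a xs i) (nth a xs j) = h i j.
  case: i j => [|[|[|[|[|i]]]]] [|[|[|[|[|[|j]]]]]] //= _ _;
  rewrite /h /doubled_triangle /=;
  first [ by rewrite ?(ex, ey, ez) | by rewrite E12 // ?(x1b, y1b, z1b)
    | by rewrite E13 // ?(x1b, y1b, z1b) | by rewrite E23 // ?(x1b, y1b, z1b)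
    | by rewrite es E12 // ?(x1b, y1b, z1b) andbC
    | by rewrite es E13 // ?(x1b, y1b, z1b) andbC
    | by rewrite es E23 // ?(x1b, y1b, z1b) andbC ].
(* An odd number of twin pairs leads to the half-cube, an even number to the net, which is already
   there when all three pairs are pendant edges. *)
move: @h hi hs eh; case: (e x2 b); case: (e y2 c); case: (e z2 a) => h hi hs eh.
- by constructor 3; apply: (@has_pattern_seq _ _ _ _ h [:: 0; 1; 2]
    [:: 0; 1; 3; 2; 4; 5] a xs).
- by constructor 2; apply: (@has_pattern_seq _ _ _ _ h [:: 0; 1; 0]
    [:: 0; 1; 2; 3; 4; 5] a xs).
- by constructor 2; apply: (@has_pattern_seq _ _ _ _ h [:: 0; 2; 0]
    [:: 0; 1; 2; 3; 4; 5] a xs).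
- by constructor 3; apply: (@has_pattern_seq _ _ _ _ h [:: 0]
    [:: 0; 1; 3; 2; 4; 5] a xs).
- by constructor 2; apply: (@has_pattern_seq _ _ _ _ h [:: 1; 2; 1]
    [:: 0; 1; 2; 3; 4; 5] a xs).
- by constructor 3; apply: (@has_pattern_seq _ _ _ _ h [:: 1]
    [:: 1; 0; 4; 2; 3; 5] a xs).
- by constructor 3; apply: (@has_pattern_seq _ _ _ _ h [:: 2]
    [:: 2; 0; 5; 1; 3; 4] a xs).
- by constructor 2; apply: (@has_pattern_seq _ _ _ _ h [::]
    [:: 0; 1; 2; 3; 4; 5] a xs).
Qed.

Lemma tri_sub e s1 s2 s3 : tripartition A e s1 s2 s3 -> {subset s1 <= A}.
Proof. by case=> _ m _ _ _ x hx; rewrite -m mem_cat hx. Qed.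

(** Thinness of [s1] makes [a] adjacent to [c] as well as to [b]. If [b] and [c] are not adjacent,
    complementing at [a] joins them and completes the triangle. *)
Lemma tri_center e s1 s2 s3 a a' b c : graph_rel e ->
  tripartition A e s1 s2 s3 -> conn e A ->
  a \in s1 -> a' \in s1 -> b \in s2 -> c \in s3 -> e a b -> e a' c ->
  layout e A \/ obstructed e.
Proof.
move=> ge tri cA a1 a1' b2 c3 ab ac'; have [es ei] := ge.
have ac : e a c.
  have := tri_thin tri a1 a1' (_ : b \in s2 ++ s3) (_ : c \in s2 ++ s3).
  by rewrite !mem_cat b2 c3 !orbT ab ac' => /(_ isT isT) /esym/andP[].
have ca : e c a by rewrite es.
case: (boolP (e b c)) => bc; first exact: (tri_core ge tri cA a1 b2 c3).
have aA : a \in A by apply: tri_sub a1; exact: tri.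
have bnc : b != c.
  apply/eqP => ebc; have := tri_disjoint (tri_rot tri) b2.
  by rewrite mem_cat ebc c3.
have tri2 := tri_rot tri; have tri3 := tri_rot tri2.
have tri' : tripartition A (lc e a) s1 s2 s3.
  have [u m k1 k2 k3] := tri.
  by split=> //; apply: chain_lc => //; apply: tri_sub;
    [exact: tri|exact: tri2|exact: tri3].
have [] := @tri_core (lc e a) s1 s2 s3 a b c _ tri' _ a1 b2 c3.
- exact: graph_lc.
- exact: conn_lc.
- by rewrite /lc ei ab andbF.
- by rewrite /lc (negbTE bc) ab ac bnc.
- by rewrite /lc ei ca !andbF.
- by move/(layout_lcV ge aA); left.
- by move/(@obstructed_lcs _ _ [:: a]); right.
Qed.

Lemma tri_edge e s1 s2 s3 x y : tripartition A e s1 s2 s3 -> conn e A ->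
  x \in s1 -> y \in s2 ++ s3 ->
  exists a b, [/\ a \in s1, b \in s2 ++ s3 & e a b].
Proof.
move=> tri cA x1 y23; have [_ m _ _ _] := tri.
have [||| a [b []]] := cA [set z in s1].
- by apply/subsetP => z; rewrite inE -m mem_cat => ->.
- by apply/set0Pn; exists x; rewrite inE.
- apply/eqP => /setP/(_ y); rewrite inE -m mem_cat y23 orbT => y1.
  by rewrite (tri_disjoint tri y1) in y23.
rewrite !inE -m mem_cat => a1 /andP[/negbTE-> /= b23] ab.
by exists a, b.
Qed.

(** If no part is empty, connectivity gives edges leaving each part, and so one of the three parts
    has edges to both others. *)
Lemma tri_main e s1 s2 s3 : graph_rel e ->
  tripartition A e s1 s2 s3 -> conn e A -> layout e A \/ obstructed e.
Proof.
move=> ge tri cA; have [es ei] := ge.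
have tri2 := tri_rot tri; have tri3 := tri_rot tri2.
case E1: s1 => [|x1 r1].
  by left; apply: (tri_layout0 ge (s2 := s2) (s3 := s3)); rewrite -E1.
case E2: s2 => [|x2 r2].
  by left; apply: (tri_layout0 ge (s2 := s3) (s3 := s1)); rewrite -E2.
case E3: s3 => [|x3 r3].
  by left; apply: (tri_layout0 ge (s2 := s1) (s3 := s2)); rewrite -E3.
have h1 : x1 \in s1 by rewrite E1 mem_head.
have h2 : x2 \in s2 by rewrite E2 mem_head.
have h3 : x3 \in s3 by rewrite E3 mem_head.
have [|a [b [a1 + ab]]] := tri_edge (y := x2) tri cA h1; first by rewrite mem_cat h2.
rewrite mem_cat => /orP[b2|b3].
  have [|c [d [c3 + cd]]] := tri_edge (y := x1) tri3 cA h3.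
    by rewrite mem_cat h1.
  rewrite es in cd; rewrite mem_cat => /orP[d1|d2].
    exact: (tri_center ge tri cA a1 d1 b2 c3).
  by rewrite es in ab; exact: (tri_center ge tri2 cA d2 b2 c3 a1).
have [|c [d [c2 + cd]]] := tri_edge (y := x1) tri2 cA h2.
  by rewrite mem_cat h1 orbT.
rewrite es in cd; rewrite mem_cat => /orP[d3|d1].
  by rewrite es in ab; exact: (tri_center ge tri3 cA b3 d3 a1 c2).
exact: (tri_center ge tri cA d1 a1 c2 b3).
Qed.

(** * Reinserting a vertex of a thin pair *)

(** As the pair is thin and [w] has the outside neighbour [y], the column of [v] on [X] is a
    multiple of that of [w]. Adding [v] on the side of [w] thus does not raise the rank. *)
Lemma twin_thin e (X : {set T}) v w y : graph_rel e ->
  thin e [set v; w] (A :\: [set v; w]) -> y \in A :\: [set v; w] -> e w y ->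
  v \notin X -> w \notin X -> X \subset A ->
  v \in A -> w \in A -> v != w ->
  thin e X ((A :\ v) :\: X) -> thin e X (A :\: X).
Proof.
move=> [es ei] tw yA wy vX wX XA vA wA vw th.
have col p : p \in X -> e p v = e p w && e v y.
  move=> pX; have pA : p \in A :\: [set v; w].
    rewrite !inE (subsetP XA) // andbT negb_or.
    by apply/andP; split; [move: vX|move: wX]; apply: contraNneq => <-.
  have := tw v w p y (set21 _ _) (set22 _ _) pA yA.
  by rewrite wy andbT !(es p) andbC => ->; rewrite andbC.
have wr : w \in (A :\ v) :\: X by rewrite !inE wX wA eq_sym vw.
have key p p' q : p \in X -> p' \in X -> q \in A :\: X ->
    e p q && e p' w = e p w && e p' q.
  move=> hp hp' hq; have [->|qv] := eqVneq q v.
    by rewrite !col //; case: (e p w); case: (e p' w); case: (e v y).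
  apply: th => //; first by move: hq; rewrite !inE qv.
move=> p p' q q' hp hp' hq hq'.
have [->|qv] := eqVneq q v.
  rewrite !col //; move: (key p p' q' hp hp' hq').
  by case: (e p w); case: (e p' w); case: (e v y); case: (e p q'); case: (e p' q').
have [->|qv'] := eqVneq q' v.
  rewrite !col //; move: (key p p' q hp hp' hq).
  by case: (e p w); case: (e p' w); case: (e v y); case: (e p q); case: (e p' q).
by apply: th => //; [move: hq|move: hq']; rewrite !inE ?qv ?qv'.
Qed.

(** Taking [w] out of a layout [P], [w], [S] of [A :\ v] leaves two chains, [P] and the reversal of
    [S]; the pair of [v] and [w] is the third part of a tripartition. *)
Lemma twin_extend e v w y : graph_rel e -> conn e A ->
  v \in A -> w \in A -> v != w -> thin e [set v; w] (A :\: [set v; w]) ->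
  y \in A :\: [set v; w] -> e w y -> layout e (A :\ v) ->
  layout e A \/ obstructed e.
Proof.
move=> ge cA vA wA vw tw yA wy [s [us ms hs]].
have ws : w \in s by rewrite ms !inE eq_sym vw.
case/splitPr: ws us ms hs => P S us ms hs.
have vPS : v \notin P ++ w :: S by rewrite ms !inE eqxx.
move: (vPS); rewrite mem_cat inE !negb_or => /and3P[vP _ vS].
move: (us); rewrite uniq_catC /= mem_cat negb_or => /andP[/andP[wS wP] uSP].
have lift L : v \notin L -> w \notin L -> {subset L <= P ++ w :: S} ->
    (thin e L [pred x in P ++ w :: S | x \notin L]) ->
    thin e [set x in L] (A :\: [set x in L]).
  move=> vL wL LA th.
  apply: (twin_thin ge tw yA wy) => //; rewrite ?inE //.
    by apply/subsetP => x; rewrite inE => /LA; rewrite ms inE => /andP[].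
  apply: thinS th => x /=; rewrite ?inE // ms !inE => /and3P[-> -> ->].
  by [].
apply: (@tri_main e P (rev S) [:: v; w]) => //; split.
- rewrite catA uniq_catC /= inE !mem_cat !mem_rev (negbTE vw) (negbTE vP).
  rewrite (negbTE vS) (negbTE wP) (negbTE wS) /= uniq_catC.
  by rewrite -(perm_uniq (s1 := S ++ P)) // perm_cat2r perm_sym perm_rev.
- move=> x; rewrite !mem_cat mem_rev !inE.
  have := ms x; rewrite mem_cat !inE => h.
  have [->|xv] := eqVneq x v; first by rewrite vA !orbT.
  by rewrite xv /= in h; rewrite -h /= [(x == w) || _]orbC.
- move=> L1 L2 eP; apply: lift.
  + by move: vP; rewrite eP mem_cat negb_or => /andP[].
  + by move: wP; rewrite eP mem_cat negb_or => /andP[].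
  + by move=> x hx; rewrite eP !mem_cat hx.
  + apply: thinS (hs L1 (L2 ++ w :: S) _) => //; last by rewrite eP catA.
    by move=> x; rewrite inE eP -catA mem_cat => /andP[/orP[->|]].
- move=> L1 L2 /(congr1 rev); rewrite revK rev_cat => eS; apply: lift.
  + by move: vS; rewrite eS mem_cat !mem_rev negb_or => /andP[].
  + by move: wS; rewrite eS mem_cat !mem_rev negb_or => /andP[].
  + by move=> x hx; rewrite eS !(mem_cat, inE) !mem_rev hx !orbT.
  + apply: thinC => //.
    apply: thinS (hs (P ++ w :: rev L2) (rev L1) _) => //=.
    * move=> x; rewrite inE eS -cat_cons catA mem_cat mem_rev => /andP[/orP[//|]].
      by move=> ->.
    * by move=> x; rewrite mem_rev.
    * by rewrite eS -cat_cons catA.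
- move=> [|x [|x' [|//]]] L2 /=.
  + by move=> _ p p' q q' /=; rewrite inE.
  + by move=> _; apply: (@thin1 _ _ _ _ x) => z; rewrite !inE => /eqP.
  + case=> <- <- _; apply: thinS tw => z /=; rewrite !inE //.
Qed.

(** An edge leaves the pair, since [A] is larger and connected. Its end in the pair stays, and the
    other vertex of the pair is removed and reinserted. *)
Lemma twin_case e v w : graph_rel e -> conn e A -> 2 < #|A| ->
  v \in A -> w \in A -> v != w -> thin e [set v; w] (A :\: [set v; w]) ->
  (forall u, u \in A -> layout e (A :\ u)) ->
  layout e A \/ obstructed e.
Proof.
move=> ge cA A3 vA wA vw tw IH.
have [||| x [y [+ yA xy]]] := cA [set v; w].
- by apply/subsetP => z; rewrite !inE => /orP[]/eqP->.
- by apply/set0Pn; exists v; rewrite !inE eqxx.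
- by apply: contraTneq A3 => <-; rewrite cards2 vw.
rewrite !inE => /orP[]/eqP ex; rewrite ex in xy; last first.
  exact: (twin_extend ge cA vA wA vw tw yA xy (IH v vA)).
rewrite setUC in tw yA; rewrite eq_sym in vw.
exact: (twin_extend ge cA wA vA vw tw yA xy (IH w wA)).
Qed.
End TripartitionTheorem.

(** * Leaves and 5-cycles *)

Section ExistenceOfLayouts.
Variable T : finType.
Implicit Types (e : rel T) (A K X : {set T}) (s t p : seq T).

Lemma thin_pair_row0 e A a b : (forall x, x \in A :\: [set a; b] -> e a x = false) ->
  thin e [set a; b] (A :\: [set a; b]).
Proof.
move=> h p p' q q' /= hp hp' /h hq /h hq'; move: hp hp'.
by rewrite !inE => /orP[]/eqP-> /orP[]/eqP->; rewrite ?hq ?hq' ?andbF // andbC.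
Qed.

Lemma thin_pair_eq e A a b : (forall x, x \in A :\: [set a; b] -> e a x = e b x) ->
  thin e [set a; b] (A :\: [set a; b]).
Proof.
move=> h p p' q q' /= hp hp' /h hq /h hq'; move: hp hp'.
by rewrite !inE => /orP[]/eqP-> /orP[]/eqP->; rewrite ?hq ?hq' andbC.
Qed.

Lemma conn_addv e K x y : graph_rel e -> conn e K -> x \in K -> e x y ->
  conn e (y |: K).
Proof.
move=> [es ei] cK xK exy Z ZS Z0 ZnS.
have [/eqP ZK0|ZK0] := boolP (Z :&: K == set0).
  have yZ : y \in Z.
    have /set0Pn[z zZ] := Z0; have := subsetP ZS _ zZ.
    rewrite !inE => /orP[/eqP<-//|zK].
    by have := in_set0 z; rewrite -ZK0 inE zZ zK.
  exists y, x; rewrite es exy yZ; split=> //; rewrite !inE xK orbT andbT.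
  by apply/negP => xZ; have := in_set0 x; rewrite -ZK0 inE xZ xK.
have [/eqP ZK|ZK] := boolP (Z :&: K == K).
  have KZ : K \subset Z by apply/setIidPr.
  exists x, y; split=> //; first exact: subsetP KZ _ xK.
  rewrite !inE eqxx andbT; apply: contra ZnS => yZ.
  by rewrite eqEsubset ZS subUset KZ sub1set yZ.
have [//|p [q [+ + epq]]] := cK (Z :&: K) (subsetIr _ _) ZK0.
rewrite !inE => /andP[pZ pK] /andP[+ qK]; rewrite qK andbT => qZ.
by exists p, q; rewrite !inE pZ qZ qK orbT.
Qed.

(** A maximal connected proper subset stays connected when a vertex [y] adjacent to it is added, so
    by maximality it is [A :\ y]. *)
Lemma conn_delete e A : graph_rel e -> conn e A -> 1 < #|A| ->
  exists2 v, v \in A & conn e (A :\ v).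
Proof.
move=> ge cA A1; have [es ei] := ge.
have /set0Pn[a aA] : A != set0 by rewrite -card_gt0; apply: ltn_trans A1.
pose P (X : {set T}) := [&& X \subset A, X != A, X != set0 & `[< conn e X >]].
have Pa : P [set a].
  apply/and4P; split; rewrite ?sub1set //.
  - by apply: contraTneq A1 => <-; rewrite cards1.
  - by apply/set0Pn; exists a; rewrite inE.
  - apply/asboolP => X; rewrite subset1 => /orP[]/eqP->; by rewrite eqxx.
have [X mX _] := maxset_exists Pa.
have [/and4P[XA XnA X0 /asboolP cX] mX'] := maxsetP mX.
have [x [y [xX + exy]]] := cA X XA X0 XnA.
rewrite inE => /andP[yX yA].
have yXA : y |: X = A.
  apply: contraTeq yX => nA.
  rewrite negbK -(mX' (y |: X)) ?setU11 ?subsetUr //.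
  apply/and4P; split=> //.
  - by rewrite subUset sub1set yA XA.
  - by apply/set0Pn; exists y; rewrite setU11.
  - by apply/asboolP; apply: conn_addv exy.
by exists y => //; rewrite -yXA setU1K.
Qed.

Lemma conn_path e K b d : conn e K -> b \in K -> d \in K ->
  exists p, [/\ path e b p, {subset p <= K} & last b p = d].
Proof.
move=> cK bK dK; pose r : rel T := [rel x y | e x y && (y \in K)].
have /connectP[p pp ->] : connect r b d.
  apply: contraT => nbd; pose X := [set x in K | connect r b x].
  have [|||x [y [+ + exy]]] := cK X.
  - by apply/subsetP => x; rewrite inE => /andP[].
  - by apply/set0Pn; exists b; rewrite inE bK connect0.
  - by apply: contraNneq nbd => XK; move: dK; rewrite -XK inE => /andP[].
  rewrite !inE => /andP[xK bx] /andP[+ yK]; rewrite yK /= => /negP[].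
  by apply: connect_trans bx (connect1 _); rewrite /r /= exy yK.
exists p; split=> //; first by apply: sub_path pp => x y /andP[].
move=> x; elim: p b bK pp => // y p IH b bK /= /andP[/andP[_ yK] pp].
by rewrite inE => /orP[/eqP->//|]; apply: IH pp.
Qed.

(** This is a leaf within [K] only: adjacency of [a] to vertices outside [K], such as the deleted
    vertex, is left open. *)
Definition leaf_at e K a b :=
  [/\ a \in K, b \in K & {in K, forall x, e a x = (x == b)}].

(** Complementing at [r] can change the edges at [a] only if [r] is adjacent to [a], which inside
    [K] means [r = b]. *)
Lemma leaf_lcs e K a b t : graph_rel e -> {subset t <= K} -> b \notin t ->
  leaf_at e K a b -> leaf_at (lcs e t) K a b.
Proof.
elim: t e => //= r t IH e ge tK; rewrite inE negb_or => /andP[br bt] [aK bK h].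
apply: IH => //; first exact: graph_lc.
  by move=> x hx; apply: tK; rewrite inE hx orbT.
have [es ei] := ge.
split=> // x xK; rewrite /lc h // es h ?tK ?mem_head // [r == b]eq_sym (negbTE br).
by rewrite /= andbF addbF.
Qed.

Lemma row0_leaf e K c d : conn e K -> c \in K -> d \in K -> c != d ->
  graph_rel e -> {in K :\: [set c; d], forall x, e c x = false} ->
  leaf_at e K c d.
Proof.
move=> cK cK' dK cd [es ei] h; split=> // x xK.
have [|||y [z [+ + exy]]] := cK [set c].
- by rewrite sub1set.
- by apply/set0Pn; exists c; rewrite inE.
- by apply: contraNneq cd => E; move: dK; rewrite -E inE eq_sym.
rewrite !inE => /eqP ey /andP[zc zK]; subst y.
have zd : z = d.
  apply/eqP; apply: contraTT exy => zd; rewrite h // !inE zK andbT.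
  by rewrite negb_or zc zd.
subst z; have [->|xd] := eqVneq x d; first by rewrite exy.
have [->|xc] := eqVneq x c; first by rewrite ei.
by rewrite h // !inE negb_or xc xd.
Qed.

(** Unless one of the rows vanishes, [c] and [d] have equal rows and are twins. Complementing at one
    of two true twins makes the other pendant; false twins become true ones by complementing at a
    common neighbour. Avoiding [b] lets a leaf already attached to [b] survive. *)
Lemma pair_leaf e K b c d : graph_rel e -> conn e K ->
  c \in K -> d \in K -> c != d -> b \notin [set c; d] ->
  thin e [set c; d] (K :\: [set c; d]) ->
  exists t f g, [/\ {subset t <= K}, b \notin t, f \in [set c; d] &
    leaf_at (lcs e t) K f g].
Proof.
move=> ge cK cK' dK cd bcd th; have [es ei] := ge.
have dc : d != c by rewrite eq_sym.
have [bc bd] : b != c /\ b != d by move: bcd; rewrite !inE negb_or => /andP[].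
set R := K :\: [set c; d].
have R_c x : x \in R -> c != x.
  by apply: contraTneq => <-; rewrite !inE eqxx.
have R_d x : x \in R -> d != x.
  by apply: contraTneq => <-; rewrite !inE eqxx orbT.
have R_K x : x \in R -> x \in K by rewrite inE => /andP[].
have KS : forall r, r \in K -> {subset [:: r] <= K}.
  by move=> r rK x; rewrite inE => /eqP->.
have [[y yR cy]|nc] := pselect (exists2 y, y \in R & e c y); last first.
  exists [::], c, d; split=> //; first by rewrite !inE eqxx.
  apply: row0_leaf => // x xR; apply/negP => cx; apply: nc; by exists x.
have [[z zR dz]|nd] := pselect (exists2 z, z \in R & e d z); last first.
  exists [::], d, c; split=> //; first by rewrite !inE eqxx orbT.
  apply: row0_leaf => // x; rewrite setUC => xR; apply/negP => dx.
  by apply: nd; exists x.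
have dy : e d y.
  have := th c d y z (set21 _ _) (set22 _ _) yR zR.
  by rewrite cy dz => /esym/andP[].
have eqr x : x \in R -> e c x = e d x.
  move=> xR; have := th c d y x (set21 _ _) (set22 _ _) yR xR.
  by rewrite cy dy andbT => <-.
have true_twins e' : graph_rel e' -> conn e' K -> e' c d ->
    {in R, forall x, e' c x = e' d x} -> leaf_at (lc e' c) K d c.
  move=> ge' cK2 ecd eqr'; apply: row0_leaf => //.
  - exact: conn_lc.
  - exact: graph_lc.
  move=> x; rewrite setUC => xR.
  by rewrite /lc (eqr' x) // R_d // ecd /=; case: (e' d x).
have [ecd|necd] := boolP (e c d).
  exists [:: c], d, c; split=> //; [exact: KS|by rewrite inE|by rewrite !inE eqxx orbT|].
  exact: true_twins.
have [[r rR /andP[cr rb]]|nr] := pselect (exists2 r, r \in R & e c r && (r != b)).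
  exists [:: r; c], d, c; split.
  - by move=> x; rewrite !inE => /orP[]/eqP-> //; exact: R_K.
  - by rewrite !inE negb_or eq_sym rb.
  - by rewrite !inE eqxx orbT.
  have dr : e d r by rewrite -eqr.
  apply: true_twins.
  - exact: graph_lc.
  - by apply: conn_lc => //; exact: R_K.
  - by rewrite /lc (negbTE necd) cd [e r c]es cr [e r d]es dr.
  - by move=> x xR; rewrite /lc (eqr x) // R_c // R_d // [e r c]es cr [e r d]es dr.
(* No outside neighbour other than [b] remains, so [c] is already a leaf, attached to [b]. *)
exists [::], c, y; split=> //; first by rewrite !inE eqxx.
have yb : y = b.
  by apply/eqP; apply: contraT => yb; case: nr; exists y; rewrite // cy.
split=> //=; first exact: R_K.
move=> x xK; have [->//|xy] := eqVneq x y.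
have [->|xc] := eqVneq x c; first by rewrite ei.
have [->|xd] := eqVneq x d; first by rewrite (negbTE necd).
apply/negP => cx; apply: nr; exists x; first by rewrite !inE negb_or xc xd.
by rewrite cx -yb.
Qed.

(** The first two and the last two vertices of the layout form disjoint thin pairs. One leaf is made
    from the first pair, then another from the second without complementing at the neighbour of the
    first leaf. *)
Lemma two_leaves e K : graph_rel e -> conn e K -> layout e K -> 3 < #|K| ->
  exists t a b c d, [/\ {subset t <= K}, a != c,
    leaf_at (lcs e t) K a b & leaf_at (lcs e t) K c d].
Proof.
move=> ge cK [s [us ms hs]].
have -> : #|K| = size s by rewrite -(card_uniqP us); apply: eq_card.
case: s us ms hs => [|x1 [|x2 r]] //.
case/lastP: r => [//|r y2]; case/lastP: r => [//|r y1].
rewrite -!cats1 -catA /= => us ms hs _.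
have [x1K x2K] : x1 \in K /\ x2 \in K by rewrite -!ms !inE !eqxx !orbT.
have [y1K y2K] : y1 \in K /\ y2 \in K.
  by rewrite -!ms !inE !mem_cat !inE !eqxx !orbT.
move: (us); rewrite inE negb_or => /andP[/andP[x12 nx1] /andP[nx2]].
rewrite cat_uniq => /and3P[_ ny /= /andP[]]; rewrite inE => y12 _.
move: nx1 nx2; rewrite !mem_cat !inE !negb_or.
move=> /and3P[_ x1y1 x1y2] /and3P[_ x2y1 x2y2].
have th1 : thin e [set x1; x2] (K :\: [set x1; x2]).
  apply: thinS (hs [:: x1; x2] (r ++ [:: y1; y2]) erefl) => x /=.
    by rewrite !inE.
  by rewrite !inE -ms !inE negb_or => /andP[/andP[/negbTE-> /negbTE->]].
have th2 : thin e [set y1; y2] (K :\: [set y1; y2]).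
  apply: thinC => //.
  apply: thinS (hs (x1 :: x2 :: r) [:: y1; y2] erefl) => x /=; last first.
    by rewrite !inE.
  rewrite !inE -ms !inE mem_cat !inE negb_or => /andP[/andP[/negbTE-> /negbTE->]].
  by rewrite ?inE !orbF.
have b1 : y1 \notin [set x1; x2] by rewrite !inE negb_or ![y1 == _]eq_sym x1y1.
have [t1 [a [b [t1K _ ax lab]]]] := pair_leaf ge cK x1K x2K x12 b1 th1.
pose e1 := lcs e t1; have ge1 : graph_rel e1 by exact: graph_lcs.
have cK1 : conn e1 K by exact: conn_lcs.
have [aK bK hab] : leaf_at e1 K a b := lab.
have th2' : thin e1 [set y1; y2] (K :\: [set y1; y2]).
  apply: thin_lcs => //; apply/subsetP => x; rewrite !inE.
  by case/orP => /eqP->.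
have [ay1 ay2] : a != y1 /\ a != y2.
  by move: ax; rewrite !inE => /orP[]/eqP->.
have aR : a \in K :\: [set y1; y2] by rewrite !inE negb_or ay1 ay2.
have [es1 ei1] := ge1.
have eab : e1 a b by rewrite hab // eqxx.
(* If [b] lies in the second pair, no further complementing is needed: [a] is adjacent to [b] but
   not to the other vertex [w], so thinness makes the row of [w] vanish outside the pair. *)
have direct u w : u \in K -> w \in K -> u != w -> [set y1; y2] = [set u; w] ->
    b = u -> a != w ->
  exists t a b c d, [/\ {subset t <= K}, a != c,
    leaf_at (lcs e t) K a b & leaf_at (lcs e t) K c d].
  move=> uK wK uw E bu aw; exists t1, a, b, w, u; split=> //.
  apply: (@row0_leaf e1) => //; first by rewrite eq_sym.
  move=> x; rewrite setUC -E => xR.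
  have := th2' u w a x; rewrite E set21 set22 -E => /(_ isT isT aR xR).
  rewrite -bu ![e1 _ a]es1 eab hab // eq_sym bu (negbTE uw) /= => ->.
  by rewrite andbF.
have [bu|bu] := eqVneq b y1; first exact: (direct y1 y2).
have [bu'|bu'] := eqVneq b y2.
  by apply: (direct y2 y1) => //; [rewrite eq_sym|rewrite setUC].
have b2 : b \notin [set y1; y2] by rewrite !inE negb_or bu.
have [t2 [c [d [t2K bt2 cy lcd]]]] := pair_leaf ge1 cK1 y1K y2K y12 b2 th2'.
exists (t1 ++ t2), a, b, c, d; rewrite lcs_cat; split=> //.
- by move=> x; rewrite mem_cat => /orP[/t1K|/t2K].
- by move: cy; rewrite !inE => /orP[]/eqP->.
- exact: leaf_lcs.
Qed.

(** The cycle [v], [a], [b], [d], [c], numbered from 0 to 4, with optional chords from [v] to [b]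
    and from [v] to [d]. *)
Definition chorded_C5 (p q : bool) : rel nat := fun i j =>
  [|| pattern C5_edges i j, p && pattern [:: (0, 2)] i j
    | q && pattern [:: (0, 3)] i j].

Lemma obstructed_short e K v a b c d : graph_rel e -> v \notin K ->
  leaf_at e K a b -> leaf_at e K c d -> a != c -> b != d -> a != d -> c != b ->
  e v a -> e v c -> e b d -> obstructed e.
Proof.
move=> ge vK [aK bK hab] [cK dK hcd] ac bd ad cb va vc ebd.
have [es ei] := ge.
have vN x : x \in K -> v == x = false.
  by move=> xK; apply: contraNF vK => /eqP->.
have ab : a == b = false by apply/eqP => E; have := hab b bK; rewrite -E ei eqxx.
have cd : c == d = false by apply/eqP => E; have := hcd d dK; rewrite -E ei eqxx.
set xs := [:: v; a; b; d; c].
have uxs : uniq xs.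
  rewrite /= !inE !vN // (negbTE ac) (negbTE bd) (negbTE ad) ab.
  by rewrite eq_sym (negbTE cb) eq_sym cd.
set h := chorded_C5 (e v b) (e v d).
have hi i : i < 5 -> h i i = false.
  by rewrite /h /chorded_C5 /pattern eqxx !andbF.
have hs i j : i < 5 -> j < 5 -> h i j = h j i.
  rewrite /h /chorded_C5 /pattern [j == i]eq_sym => _ _.
  by rewrite ![((i, j) \in _) || _]orbC.
have eh i j : i < j -> j < 5 -> e (nth a xs i) (nth a xs j) = h i j.
  case: i j => [|[|[|[|i]]]] [|[|[|[|[|j]]]]] //= _ _;
  rewrite /h /chorded_C5 /pattern /= ?andbF ?andbT ?orbF //.
  - by rewrite hab ?eqxx.
  - by rewrite hab // eq_sym (negbTE bd).
  - by rewrite hab // (negbTE cb).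
  - by rewrite es hcd // (negbTE bd).
  - by rewrite es hcd // eqxx.
(* A chord is removed by complementing at [a] or [c], numbers 1 and 4, whose two neighbours on the
   cycle are its ends. The booleans act as repetition counts. *)
constructor 1; apply: (@has_pattern_seq _ _ _ _ h
  (nseq (e v b) 1 ++ nseq (e v d) 4) (iota 0 5) a xs) => //.
by rewrite /h; case: (e v b); case: (e v d).
Qed.

(** Induction on the length of the path. A repetition of [b] or a chord at one of the first two
    vertices gives a shortcut. Otherwise complementing at the second vertex [y] joins [b] to [z] and
    keeps the later edges, so [y] can be skipped. *)
Lemma obstructed_path e K v a b c d p : graph_rel e -> v \notin K ->
  leaf_at e K a b -> leaf_at e K c d -> a != c -> b != d -> a != d -> c != b ->
  e v a -> e v c -> path e b p -> {subset p <= K} -> last b p = d ->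
  obstructed e.
Proof.
move=> + vK + + ac bd ad cb.
have [n] := ubnP (size p); elim: n => // n IH in e p *.
case: p => [|y p] /= sp ge lab lcd va vc; first by move=> _ _ /eqP; rewrite (negbTE bd).
have [es ei] := ge; have [aK bK hab] := lab; have [cK dK hcd] := lcd.
case/andP=> eby pp pK lp.
have [yd|yd] := eqVneq y d.
  by rewrite yd in eby; exact: (obstructed_short ge vK lab lcd).
have shorten q : size q < (size p).+1 -> {subset q <= K} -> path e b q ->
    last b q = d -> obstructed e.
  by move=> sq qK pq lq; apply: (IH e q) => //; apply: leq_trans sq _.
case: p pp pK lp sp shorten => [|z p] pp pK lp sp shorten.
  by move: yd; rewrite -lp /= eqxx.
have [/hasP[q qp ebq]|/hasPn nb] := boolP (has (e b) (z :: p)).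
  case/splitPr: qp pp pK lp sp shorten => q1 q2 pp pK lp sp shorten.
  move: pp; rewrite cat_path /= => /and3P[_ _ pp].
  apply: (shorten (q :: q2)) => /=.
  - by rewrite size_cat ltnS leq_addl.
  - by move=> x hx; apply: pK; rewrite inE mem_cat hx !orbT.
  - by rewrite ebq.
  - by rewrite -lp last_cat.
have [bp|bp] := boolP (b \in z :: p).
  case/splitPr: bp pp pK lp sp shorten {nb} => q1 q2 pp pK lp sp shorten.
  move: pp; rewrite cat_path /= => /and3P[_ _ pp].
  apply: (shorten q2) => //.
  - by rewrite size_cat /= ltnS (leq_trans (leqnSn _)) ?leq_addl.
  - by move=> x hx; apply: pK; rewrite inE mem_cat inE hx !orbT.
  - by rewrite -lp last_cat.
move: pp => /= /andP[eyz pp].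
have [/hasP[q qp eyq]|/hasPn ny] := boolP (has (e y) p).
  case/splitPr: qp pp pK lp sp shorten {nb bp} => q1 q2 pp pK lp sp shorten.
  move: pp; rewrite cat_path /= => /and3P[_ _ pp].
  apply: (shorten (y :: q :: q2)) => /=.
  - by rewrite size_cat !ltnS leq_addl.
  - move=> x; rewrite inE => /orP[/eqP->|hx]; apply: pK; rewrite ?mem_head //.
    by rewrite !inE mem_cat hx !orbT.
  - by rewrite eby eyq.
  - by rewrite -lp /= last_cat.
have yK : y \in K by apply: pK; rewrite mem_head.
have yb : b != y by apply: contraTneq eby => ->; rewrite ei.
have yS : {subset [:: y] <= K} by move=> x; rewrite inE => /eqP->.
(* As [y] differs from [b] and [d], it is adjacent to neither [a] nor [c]; hence both leaves and
   their edges to [v] survive. *)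
apply: (@obstructed_lcs _ _ [:: y]); apply: (IH _ (z :: p)) => //.
- exact: graph_lc.
- by apply: (@leaf_lcs e K a b [:: y]) => //; rewrite inE.
- by apply: (@leaf_lcs e K c d [:: y]) => //; rewrite inE eq_sym.
- by rewrite /= /lc va [e y a]es hab // [y == b]eq_sym (negbTE yb) !andbF.
- by rewrite /= /lc vc [e y c]es hcd // (negbTE yd) !andbF.
- apply/andP; split.
    rewrite /= /lc (negbTE (nb _ (mem_head _ _))) es eby eyz.
    by move: bp; rewrite inE negb_or => /andP[->].
  elim: p z pp ny {pK lp sp shorten nb bp eyz} => //= x p IHp z /andP[ezx pp] ny.
  rewrite IHp // ?andbT; last by move=> u hu; apply: ny; rewrite inE hu orbT.
  by rewrite /lc ezx (negbTE (ny _ (mem_head _ _))) !andbF.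
- by move=> x hx; apply: pK; rewrite inE hx orbT.
Qed.

Lemma no_twins_obstructed e A v : graph_rel e -> v \in A ->
  (forall u w, u \in A -> w \in A -> u != w ->
    ~ thin e [set u; w] (A :\: [set u; w])) ->
  conn e (A :\ v) -> layout e (A :\ v) -> 4 < #|A| -> obstructed e.
Proof.
move=> ge vA nt cK lK A4; set K := A :\ v.
have K3 : 3 < #|K| by move: A4; rewrite (cardsD1 v) vA.
have [t [a [b [c [d [tK ac lab lcd]]]]]] := two_leaves ge cK lK K3.
apply: (@obstructed_lcs _ _ t).
have KA : {subset K <= A} by move=> x; rewrite inE => /andP[].
have {nt} nt u w : u \in A -> w \in A -> u != w ->
    ~ thin (lcs e t) [set u; w] (A :\: [set u; w]).
  move=> uA wA uw h; apply: (nt u w uA wA uw); apply: thin_lcsV h => //.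
    by move=> x /tK/KA.
  by apply/subsetP => x; rewrite !inE => /orP[]/eqP->.
have {}cK : conn (lcs e t) K by exact: conn_lcs.
have {ge}ge : graph_rel (lcs e t) by exact: graph_lcs.
move: (lcs e t) => {lK tK t}e in ge nt cK lab lcd *.
have [es ei] := ge; have [aK bK hab] := lab; have [cK' dK hcd] := lcd.
have vK : v \notin K by rewrite !inE eqxx.
have inK x u w : x \in A :\: [set u; w] -> x = v \/ [/\ x \in K, x != u & x != w].
  rewrite !inE negb_or => /andP[/andP[-> ->] ->].
  by have [|xv] := eqVneq x v; [left|right].
(* A leaf of [K] not adjacent to [v] would form a thin pair with its neighbour. *)
have adj a' b' : leaf_at e K a' b' -> e v a'.
  case=> a'K b'K h; apply: contraT => nva.
  have ab' : a' != b' by apply/eqP => E; have := h b' b'K; rewrite -E ei eqxx.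
  case: (nt a' b'); [exact: KA|exact: KA|exact: ab'|].
  apply: thin_pair_row0 => x /inK[->|[xK _ xb]]; first by rewrite es (negbTE nva).
  by rewrite h // (negbTE xb).
have va := adj _ _ lab; have vc := adj _ _ lcd.
(* Both leaves are now adjacent to [v]. They would be twins in [A] if they had the same neighbour in
   [K], or if each were the neighbour of the other. *)
have bd : b != d.
  apply/eqP => bd; case: (nt a c); [exact: KA|exact: KA|exact: ac|].
  apply: thin_pair_eq => x /inK[->|[xK _ _]]; first by rewrite !(es _ v) va vc.
  by rewrite hab // hcd // bd.
have nK2 : ~ (a = d /\ c = b).
  case=> ad cb; case: (nt a c); [exact: KA|exact: KA|exact: ac|].
  apply: thin_pair_eq => x /inK[->|[xK xa xc]]; first by rewrite !(es _ v) va vc.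
  by rewrite hab // hcd // -ad -cb (negbTE xa) (negbTE xc).
have ead : (a == d) = (c == b) by rewrite -hab // es hcd.
have ad : a != d.
  by apply/eqP => ad; apply: nK2; split=> //; apply/eqP; rewrite -ead ad.
have cb : c != b by rewrite -ead.
have [p [pp pK lp]] := conn_path cK bK dK.
exact: (obstructed_path ge vK lab lcd ac bd ad cb va vc pp).
Qed.

(** The three splittings into pairs compare the products [e x y && e z u], [e x z && e y u] and
    [e x u && e y z] two at a time, and two of three booleans agree. *)
Lemma four_twins e A : graph_rel e -> #|A| = 4 ->
  exists v w, [/\ v \in A, w \in A, v != w &
    thin e [set v; w] (A :\: [set v; w])].
Proof.
move=> [es ei]; rewrite cardE.
have := mem_enum A; have := enum_uniq A.
case: (enum A) => [|x [|y [|z [|u [|]]]]] //= + mA _.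
rewrite !inE !negb_or andbT => /and3P[/and3P[xy xz xu] /andP[yz yu] zu].
have mem w : w \in A = [|| w == x, w == y, w == z | w == u].
  by rewrite -mA !inE.
have key (p q r w : T) : (forall o, o \in A = [|| o == p, o == q, o == r | o == w]) ->
    e p r && e q w = e p w && e q r ->
    thin e [set p; q] (A :\: [set p; q]).
  move=> memp E i i' j j' /= hi hi'.
  rewrite !inE !memp !negb_or.
  case/andP=> /andP[/negbTE-> /negbTE->] /= hj.
  case/andP=> /andP[/negbTE-> /negbTE->] /= hj'.
  move: hi hi' hj hj'; rewrite !inE.
  by do 4! (case/orP=> /eqP->); move: E;
    case: (e p r); case: (e q w); case: (e p w); case: (e q r).
have [xA [yA [zA uA]]] : x \in A /\ y \in A /\ z \in A /\ u \in A.
  by rewrite !mem !eqxx !orbT.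
have mem2 w : w \in A = [|| w == x, w == z, w == y | w == u].
  by rewrite mem; case: (w == x); case: (w == y); case: (w == z).
have mem3 w : w \in A = [|| w == x, w == u, w == y | w == z].
  by rewrite mem; case: (w == x); case: (w == y); case: (w == z); case: (w == u).
have [E1|E1] := boolP (e x z && e y u == e x u && e y z).
  by exists x, y; split=> //; apply: (key _ _ z u) => //; apply/eqP.
have [E2|E2] := boolP (e x y && e z u == e x u && e z y).
  by exists x, z; split=> //; apply: (key _ _ y u) => //; apply/eqP.
exists x, u; split=> //; apply: (key _ _ y z) => //.
move: E1 E2; rewrite (es z y) (es u z) (es u y).
by case: (e x y); case: (e x z); case: (e x u); case: (e y z); case: (e y u);
  case: (e z u).
Qed.

Lemma layout_small e A : #|A| <= 3 -> layout e A.
Proof.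
move=> A3; exists (enum A); split; first exact: enum_uniq.
  by move=> x; rewrite mem_enum.
move=> s1 s2 es; have : size s1 + size s2 <= 3 by rewrite -size_cat -es -cardE.
case: s1 {es} => [|x [|x' s1]] /=.
- by move=> _ p p' q q'; rewrite in_nil.
- by move=> _; apply: (@thin1 _ _ _ _ x) => y; rewrite inE => /eqP.
case: s2 => [|y [|y' s2]] /=.
- by move=> _ p p' q q' _ _; rewrite in_nil.
- by move=> _ p p' q q' _ _ /=; rewrite !inE => /eqP-> /eqP->.
- lia.
Qed.

Lemma layout_disjoint e A X : X \subset A -> graph_rel e ->
  (forall x y, x \in X -> y \in A :\: X -> e x y = false) ->
  layout e X -> layout e (A :\: X) -> layout e A.
Proof.
move=> XA [es ei] no [s1 [u1 m1 h1]] [s2 [u2 m2 h2]]; exists (s1 ++ s2); split.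
- rewrite cat_uniq u1 u2 andbT /=; apply/hasPn => x; rewrite m2 inE /= m1.
  by case/andP.
- move=> x; rewrite mem_cat m1 m2 !inE.
  by have [/(subsetP XA)->|] := boolP (x \in X).
have no1 x y : x \in s1 -> y \in s2 -> e x y = false.
  by rewrite m1 m2; exact: no.
move=> t1 t2 /cat_eq_cat[[k -> e2]|[k e1 ->]].
  have t2s x : x \in t2 -> x \in k ++ t2 by rewrite mem_cat orbC => ->.
  have no2 x y : x \in s1 -> y \in t2 -> e x y = false.
    by move=> hx hy; apply: no1 => //; rewrite e2 t2s.
  move=> p p' q q' /=; rewrite !mem_cat.
  case/orP=> hp; case/orP=> hp' hq hq'; try by rewrite !no2 // ?andbF.
  - by rewrite !(no2 p).
  - by rewrite !(no2 p') // !andbF.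
  - exact: (h2 k t2).
have t1s x : x \in t1 -> x \in s1 by rewrite e1 mem_cat => ->.
have no2 x y : x \in t1 -> y \in s2 -> e x y = false.
  by move=> hx hy; apply: no1 => //; rewrite t1s.
move=> p p' q q' /=; rewrite !mem_cat => hp hp'.
case/orP=> hq; case/orP=> hq'; try by rewrite !no2 // ?andbF.
- exact: (h1 t1 k).
- by rewrite !(no2 _ q') // andbF.
- by rewrite !(no2 _ q) // andbF.
Qed.

(** The predicate [obstructed e] does not mention [A], so its negation passes unchanged to the
    smaller sets of the induction. *)
Theorem layout_exists e A : graph_rel e -> ~ obstructed e -> layout e A.
Proof.
have [n] := ubnP #|A|; elim: n => // n IH in e A *.
rewrite ltnS => An ge nobs.
have [A3|A3] := leqP #|A| 3; first exact: layout_small.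
have [cA|ncA] := pselect (conn e A); last first.
  have [X XA [X0 XnA no]] : exists2 X : {set T}, X \subset A &
      [/\ X != set0, X != A &
        forall x y, x \in X -> y \in A :\: X -> e x y = false].
    apply: contrapT => nX; apply: ncA => X XA X0 XnA; apply: contrapT => ne.
    apply: nX; exists X => //; split=> // x y xX yX; apply/negP => exy.
    by apply: ne; exists x, y.
  have XpA : X \proper A by rewrite properEneq XnA.
  have cX := proper_card XpA.
  have cAX : #|A :\: X| < #|A|.
    have := cardsID X A; rewrite (setIidPr XA) => <-.
    by rewrite -[X in X < _]add0n ltn_add2r card_gt0.
  apply: (layout_disjoint XA ge no); apply: IH => //;
    [exact: leq_trans cX An|exact: leq_trans cAX An].
have step u : u \in A -> layout e (A :\ u).
  by move=> uA; apply: IH => //; move: An; rewrite (cardsD1 u) uA.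
have [[u [w [uA wA uw th]]]|nt] := pselect (exists u w, [/\ u \in A, w \in A,
    u != w & thin e [set u; w] (A :\: [set u; w])]).
  by case: (twin_case ge cA (ltnW A3) uA wA uw th step).
(* Size 4 is separate because two disjoint pairs in [A :\ v] require at least five vertices in
   [A]. *)
have [E|A4] := eqVneq #|A| 4; first by case: nt; exact: four_twins.
have [v vA cK] := conn_delete ge cA (ltnW (ltnW A3)).
case: nobs; apply: (no_twins_obstructed ge vA _ cK (step v vA)); last first.
  by rewrite ltn_neqAle eq_sym A4.
by move=> u w uA wA uw th; apply: nt; exists u, w.
Qed.
End ExistenceOfLayouts.

(** * Layouts and vertex-minors *)

Lemma filter_eq_cat (T : Type) (a : pred T) s t1 t2 : filter a s = t1 ++ t2 ->
  exists u1 u2, [/\ s = u1 ++ u2, filter a u1 = t1 & filter a u2 = t2].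
Proof.
elim: s t1 => [|x s IH] t1 /=.
  by case: t1 => //= <-; exists [::], [::].
case ax: (a x); last first.
  case/IH => u1 [u2 [-> f1 f2]]; exists (x :: u1), u2.
  by rewrite /= ax.
case: t1 => [|y t1] /=.
  by move=> <-; exists [::], (x :: s); rewrite /= ax.
case=> <- /IH[u1 [u2 [-> <- f2]]]; exists (x :: u1), u2.
by rewrite /= ax.
Qed.

Definition has_layout (G : sgraph) := layout (@sedge G) [set: G].

(** Pulling the layout back along [f] drops the vertices outside its image, and each cut of what
    remains is contained in a cut of the original. *)
Lemma layout_embed (T T' : finType) (e : rel T) (e' : rel T') (f : T' -> T) :
  injective f -> (forall x y, e (f x) (f y) = e' x y) ->
  layout e [set: T] -> layout e' [set: T'].
Proof.
move=> fi fe [s [us ms hs]]; pose g y := [pick x | f x == y].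
have gK : ocancel g f.
  by move=> y; rewrite /g; case: pickP => //= x /eqP.
have gf x : g (f x) = Some x.
  by rewrite /g; case: pickP => [x' /eqP/fi->//|/(_ x)]; rewrite eqxx.
have Es := pmap_filter gK s.
exists (pmap g s); split.
- by rewrite (pmap_uniq gK).
- move=> x; rewrite inE -(mem_map fi) Es mem_filter gf /=.
  by rewrite ms inE.
move=> t1 t2 et; rewrite et map_cat in Es.
have [u1 [u2 [/hs h f1 f2]]] := filter_eq_cat (esym Es).
have sub t u : filter g u = map f t -> {subset map f t <= u}.
  by move=> <- x; rewrite mem_filter => /andP[].
move=> p p' q q' /= hp hp' hq hq'; rewrite -!fe.
by apply: h; [apply: sub f1 _ _|apply: sub f1 _ _|apply: sub f2 _ _|
  apply: sub f2 _ _]; rewrite mem_map.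
Qed.

Lemma vertex_minor_layout H G : vertex_minor H G -> has_layout G -> has_layout H.
Proof.
elim=> {G} [G [f /bij_inj fi fe]|G v _ IH lG|G v _ IH lG].
- exact: layout_embed fe.
- apply: IH; apply: (@layout_lc _ (@sedge G) [set: G] v) => //.
  by split; [exact: sedge_sym|exact: sedge_irr].
- by apply: IH; apply: (@layout_embed _ _ _ _ val) lG => //; exact: val_inj.
Qed.

(** Vertices outside the image of [f] are deleted one at a time, until [f] is an isomorphism. *)
Lemma vertex_minor_embed (H G : sgraph) (f : H -> G) : injective f ->
  (forall x y, (f x -- f y) = (x -- y)) -> vertex_minor H G.
Proof.
have [n] := ubnP #|G|; elim: n => // n IH in G f *.
rewrite ltnS => Gn fi fe.
have [/forallP sf|] := boolP [forall y, y \in codom f].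
  apply: vm_iso; exists f => //; apply: inj_card_bij => //.
  by rewrite -(card_codom fi) subset_leq_card //; apply/subsetP.
rewrite negb_forall => /existsP[v vf].
have fv x : f x != v by apply: contraNneq vf => <-; exact: codom_f.
apply: (@vm_del_vertex _ _ v).
apply: (IH _ (fun x => exist _ (f x) (fv x) : del_vertex v)) => //.
- apply: leq_trans Gn; rewrite card_sub (eq_card (B := predC1 v)) // cardC1.
  by rewrite prednK //; apply/card_gt0P; exists v.
- by move=> x y [] /fi.
Qed.

Lemma vertex_minor_lcs (H G : sgraph) (t : seq G) (f : H -> G) : injective f ->
  (forall x y, lcs (@sedge G) t (f x) (f y) = (x -- y)) -> vertex_minor H G.
Proof.
have [n] := ubnP (size t); elim: n => // n IH in G t f *.
case: t => [|v t] st fi fe; first exact: vertex_minor_embed fe.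
by apply: (@vm_local_comp _ _ v); apply: (IH (local_comp v) t f) fe.
Qed.

Lemma vertex_minor_pattern n l (G : sgraph) :
  has_pattern n l (@sedge G) -> vertex_minor (edge_list_graph n l) G.
Proof.
case=> t [f [fi h]].
apply: (@vertex_minor_lcs _ _ t (fun i : edge_list_graph n l => f (i : 'I_n))).
  by move=> i j /fi E; apply: val_inj; apply: E; rewrite inE.
by move=> i j; rewrite h.
Qed.

Definition thinb (h : rel nat) (s1 s2 : seq nat) :=
  all (fun p => all (fun p' => all (fun q => all (fun q' =>
    h p q && h p' q' == h p q' && h p' q) s2) s2) s1) s1.

(** The cut after the first [k] vertices already fails in every ordering; this is a finite
    computation. *)
Lemma edge_list_no_layout n k l :
  all (fun s => ~~ thinb (pattern l) (take k s) (drop k s))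
    (permutations (iota 0 n)) -> ~ has_layout (edge_list_graph n l).
Proof.
move=> /allP h [s [us ms hs]]; pose s' := map val (s : seq 'I_n).
have s'P : s' \in permutations (iota 0 n).
  rewrite mem_permutations -val_enum_ord perm_map // uniq_perm ?enum_uniq //.
  by move=> x; rewrite mem_enum ms inE.
case/negP: (h _ s'P); rewrite /s' -map_take -map_drop /thinb.
have th := hs _ _ (esym (cat_take_drop k s)).
apply/allP => _ /mapP[p hp ->]; apply/allP => _ /mapP[p' hp' ->].
apply/allP => _ /mapP[q hq ->]; apply/allP => _ /mapP[q' hq' ->].
by apply/eqP; apply: th.
Qed.

Lemma layout_vertex_minor G : has_layout G <->
  [/\ ~ vertex_minor C5 G, ~ vertex_minor net G & ~ vertex_minor half_cube G].
Proof.
split=> [lG|[nC nN nQ]].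
  split=> /vertex_minor_layout/(_ lG).
  - by apply: (@edge_list_no_layout _ 2); vm_compute.
  - by apply: (@edge_list_no_layout _ 3); vm_compute.
  - by apply: (@edge_list_no_layout _ 3); vm_compute.
apply: layout_exists; first by split; [exact: sedge_sym|exact: sedge_irr].
by case=> /vertex_minor_pattern.
Qed.

(** * From decompositions to layouts *)

Lemma mxrank_le1P (F : fieldType) m n (M : 'M[F]_(m, n)) :
  \rank M <= 1 <->
  forall i i' j j', (M i j * M i' j' = M i j' * M i' j)%R.
Proof.
split=> [|h].
  rewrite -{2 3 4 5}(mulmx_base M); move: (col_base M) (row_base M).
  case: (\rank M) => [|[|//]] C R _ i i' j j'; rewrite !mxE.
    by rewrite !big_ord0 !GRing.mulr0.
  by rewrite !big_ord1 GRing.mulrACA [(R _ j * _)%R]GRing.mulrC GRing.mulrACA.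
have [->|/matrix0Pn[i0 [j0 n0]]] := eqVneq M 0%R; first by rewrite mxrank0.
(* The vanishing minors through the nonzero entry at [i0], [j0] make [M] an outer product. *)
have -> : M = (col j0 M *m ((M i0 j0)^-1 *: row i0 M))%R.
  apply/matrixP => i j; rewrite !mxE big_ord1 !mxE.
  by rewrite GRing.mulrCA -h [(M i j * _)%R]GRing.mulrC GRing.mulKf.
exact: mulmx_max_rank.
Qed.

Lemma cutrk_le1P (G : sgraph) (X : {set G}) :
  cutrk X <= 1 <-> thin (@sedge G) X (~: X).
Proof.
have natF2 (a b c d : bool) :
    ((a%:R * b%:R = c%:R * d%:R :> 'F_2)%R <-> a && b = c && d).
  rewrite -!GRing.natrM !mulnb; case: (a && b); case: (c && d); split=> //.
rewrite /cutrk; apply: (iff_trans (mxrank_le1P _)); split.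
  move=> h p p' q q' /= hp hp' hq hq'; apply/natF2.
  have := h (enum_rank_in hp p) (enum_rank_in hp p')
            (enum_rank_in hq q) (enum_rank_in hq q').
  by rewrite !mxE !enum_rankK_in.
move=> h i i' j j'; rewrite !mxE; apply/natF2; apply: h; exact: enum_valP.
Qed.

(** * Leaves along the spine of a caterpillar *)

Section Caterpillar.
Variable T : sgraph.
Hypothesis treeT : is_tree T.

Definition cut_edge (x y : T) : rel T :=
  [rel u w | (u -- w) && ([set u; w] != [set x; y])].

Lemma cut_edge_sym x y : symmetric (cut_edge x y).
Proof. by move=> u w; rewrite /cut_edge /= sedge_sym [[set w; u]]setUC. Qed.

Lemma cut_edge_connect_sym x y u w :
  connect (cut_edge x y) u w = connect (cut_edge x y) w u.
Proof. exact: (sym_connect_sym (cut_edge_sym x y)). Qed.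

Lemma cut_edge_separates x y : x -- y -> ~~ connect (cut_edge x y) x y.
Proof.
move=> xy; apply/negP => /connectP[p0 pp0 ly]; have [_ _ acy] := treeT.
case/shortenP: pp0 ly => p pp up _ ly.
apply: (acy (x :: p)).
  (* The cycle has at least three vertices: the path is neither empty nor the removed edge
     itself. *)
  case: p ly pp {up} => [|z [|z' p]] //= ly.
    by rewrite ly sedge_irr in xy.
  by rewrite ly /cut_edge /= eqxx andbF.
rewrite /ucycle /ucycleb up andbT /= rcons_path -ly sedge_sym xy andbT.
by apply: sub_path pp => u w /andP[].
Qed.

Variables (x : T) (p : seq T).
Hypotheses (pp : path (@sedge T) x p) (up : uniq (x :: p)).
Hypothesis dom : forall v, exists2 u, u \in x :: p & (u == v) || (u -- v).

Let u := nth x (x :: p).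

(** Leaves of the tree may lie on the path or beside it; a vertex beside it takes the position of
    its first neighbour on the path. *)
Definition spine_pos v :=
  if v \in x :: p then index v (x :: p) else find (@sedge T ^~ v) (x :: p).

Lemma spine_posP v : spine_pos v < (size p).+1 /\
  (u (spine_pos v) = v \/ v \notin x :: p /\ u (spine_pos v) -- v).
Proof.
rewrite /spine_pos; case: ifP => vp.
  by rewrite -[X in _ < X]/(size (x :: p)) index_mem vp /u nth_index //; split; auto.
have h : has (@sedge T ^~ v) (x :: p).
  have [w wp /orP[/eqP wv|wv]] := dom v; first by rewrite -wv wp in vp.
  by apply/hasP; exists w.
by rewrite -[X in _ < X]/(size (x :: p)) -has_find; split=> //; right;
  rewrite ?vp //; split=> //; apply: (nth_find x h).
Qed.

Lemma spine_pos_nth i : i < (size p).+1 -> spine_pos (u i) = i.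
Proof. by move=> ip; rewrite /spine_pos /u mem_nth // index_uniq. Qed.

Lemma spine_edge i : i < size p -> u i -- u i.+1.
Proof. by move=> ip; have /(pathP x)/(_ i ip) := pp. Qed.

Lemma spine_neq i j : i < (size p).+1 -> j < (size p).+1 -> i != j -> u i != u j.
Proof.
move=> ip jp; apply: contra_neq => E.
by rewrite -(spine_pos_nth ip) E spine_pos_nth.
Qed.

Lemma connect_carrier i v : i < size p ->
  connect (cut_edge (u i) (u i.+1)) (u (spine_pos v)) v.
Proof.
move=> ip; have [pv [->|[vp uv]]] := spine_posP v; first exact: connect0.
apply: connect1; rewrite /cut_edge /= uv; apply/eqP => /setP/(_ v).
rewrite !inE eqxx orbT => /esym/orP[]/eqP E; case/negP: vp; rewrite E /u;
  apply: mem_nth => //=; exact: ltnW.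
Qed.

Lemma connect_spine i j k : i < size p -> k < (size p).+1 ->
  j <= k -> (k <= i) || (i < j) ->
  connect (cut_edge (u i) (u i.+1)) (u j) (u k).
Proof.
move=> ip; elim: k => [|k IH] kp.
  by rewrite leqn0 => /eqP-> _; exact: connect0.
rewrite leq_eqVlt => /orP[/eqP->|jk] h; first by move=> *; exact: connect0.
have ip1 : i < (size p).+1 by exact: ltnW.
have kp1 : k < (size p).+1 by exact: ltnW.
have hki : k != i by case/orP: h; [move/ltn_eqF->|];
  last by move=> ij; rewrite gtn_eqF // (leq_trans ij).
apply: connect_trans (IH _ _ _) (connect1 _); first exact: ltnW.
- by [].
- by case/orP: h => [/ltnW->//|->]; rewrite orbT.
rewrite /cut_edge /= spine_edge //; apply/eqP => /setP E.
have := E (u k); rewrite !inE eqxx /= => /esym/orP[]/eqP Ek.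
  by have := spine_neq kp1 ip1 hki; rewrite Ek eqxx.
have ki : k = i.+1.
  by rewrite -(spine_pos_nth kp1) Ek spine_pos_nth.
have := E (u i); rewrite !inE eqxx /= => /orP[]/eqP Ei.
  by have := spine_neq kp1 ip1 hki; rewrite Ei eqxx.
have : i = k.+1 by rewrite -(spine_pos_nth ip1) Ei spine_pos_nth.
by rewrite ki => /eqP; rewrite -addn2 -[X in X == _]addn0 eqn_add2l.
Qed.

(** Without the spine edge, each vertex is still joined to its spine vertex and each piece of the
    spine to its end of the edge, while the two ends are separated. *)
Lemma leaf_side_spine i l : i < size p ->
  (l \in leaf_side (u i) (u i.+1)) = (spine_pos (val l) <= i).
Proof.
move=> ip; rewrite inE; have [pl _] := spine_posP (val l).
have cl := connect_carrier (val l) ip.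
have [li|il] := leqP (spine_pos (val l)) i.
  apply: connect_trans cl; rewrite cut_edge_connect_sym.
  by apply: connect_spine => //; [exact: ltnW|rewrite leqnn].
apply/negP => ci; have /negP[] := cut_edge_separates (spine_edge ip).
rewrite cut_edge_connect_sym in cl; apply: connect_trans ci _.
apply: connect_trans cl _; rewrite cut_edge_connect_sym.
by apply: connect_spine => //; rewrite leqnn orbT.
Qed.

Hypothesis deg3 : forall v : T, ~~ leaf v -> degree v = 3.

Lemma spine_nbr v i : spine_pos v = i -> (v == u i) || (u i -- v).
Proof.
by move=> <-; have [_ [->|[_ ->]]] := spine_posP v; rewrite ?eqxx ?orbT.
Qed.

(* [u i] itself may be one of the four vertices, but only if it is a leaf, and
   then the other three would be its neighbours. *)
Lemma no_four i (w : seq T) : uniq w -> size w = 4 ->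
  {in w, forall v, v = u i -> leaf v} ->
  {in w, forall v, (v == u i) || (u i -- v)} -> False.
Proof.
move=> uw sw lw nw.
have cw : #|[set v in w]| = 4 by rewrite cardsE; move/card_uniqP: uw => ->.
have sub : [set v in w] :\ u i \subset [set v | u i -- v].
  apply/subsetP => v; rewrite !inE => /andP[/negbTE vi /nw].
  by rewrite vi.
have c3 : 3 <= #|[set v in w] :\ u i|.
  by move: cw; rewrite (cardsD1 (u i)) => E; rewrite -ltnS -E; case: (_ \in _).
have d3 := leq_trans c3 (subset_leq_card sub).
have nl : ~~ leaf (u i) by rewrite /leaf /degree; apply: contraL d3 => /eqP->.
have uiw : u i \notin [set v in w].
  by rewrite inE; apply: contra nl => /lw; apply.
have := subset_leq_card sub; rewrite -[X in _ <= X]/(degree (u i)) (deg3 nl).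
have -> : [set v in w] :\ u i = [set v in w] by apply/setDidPl; rewrite disjoint_sym disjoints1.
by rewrite cw.
Qed.

(** If leaves from both sides stood at position [i], a further vertex from each side would make four
    in the closed neighbourhood of [u i], against [no_four]. *)
Lemma crowded_spine (a b : seq {v : T | leaf v}) l l' : uniq (a ++ b) ->
  {in a & b, forall k k', spine_pos (val k) <= spine_pos (val k')} ->
  1 < size a -> 1 < size b -> l \in a -> l' \in b ->
  spine_pos (val l) != spine_pos (val l').
Proof.
move=> uab ord sa sb la lb; apply/eqP => E; set i := spine_pos (val l) in E.
have other (c : seq {v : T | leaf v}) k : uniq c -> 1 < size c -> k \in c ->
    exists2 k', k' \in c & k' != k.
  move=> uc sc kc; apply/hasP; rewrite -[has _ _]negbK -all_predC; apply/negP.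
  move=> /allP h; move: sc; have : size c <= size [:: k].
    apply: uniq_leq_size => // z zc; have := h z zc.
    by rewrite /= negbK inE.
  by case: c {uc kc h} => [|? []].
move: (uab); rewrite cat_uniq => /and3P[ua _ ub].
have [l1 l1a n1] := other a l ua sa la.
have [l2 l2b n2] := other b l' ub sb lb.
have il : i < (size p).+1 by have [] := spine_posP (val l).
have p1 : spine_pos (val l1) <= i by rewrite E; exact: ord.
have p2 : i <= spine_pos (val l2) by exact: ord.
have p2s : spine_pos (val l2) < (size p).+1 by have [] := spine_posP (val l2).
(* The second leaf of a side stands at [i] too, or strictly beyond; in the latter case the spine
   continues that way and its next vertex is used instead. *)
pose w1 := if spine_pos (val l1) == i then val l1 else u i.-1.
pose w2 := if spine_pos (val l2) == i then val l2 else u i.+1.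
have valN (k k' : {v : T | leaf v}) : k != k' -> val k != val k'.
  by apply: contra_neq; exact: val_inj.
have dab k k' : k \in a -> k' \in b -> val k != val k'.
  by move=> ka kb; apply: valN; exact: uniq_cat_neq uab _ _ ka kb.
have w1P : [/\ w1 != val l, w1 != val l', w1 = u i -> leaf w1,
    (w1 == u i) || (u i -- w1) & w1 = val l1 \/ spine_pos w1 < i].
  rewrite /w1; have [E1|E1] := eqVneq (spine_pos (val l1)) i.
    split; [exact: valN|exact: dab|by move=> _; exact: (valP l1)|
      exact: spine_nbr|by left].
  have i0 : 0 < i by apply: leq_ltn_trans (leq0n (spine_pos (val l1))) _; rewrite ltn_neqAle E1.
  have ip : i.-1 < size p by rewrite prednK.
  have q := spine_pos_nth (ltnW ip : i.-1 < (size p).+1).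
  have qn : spine_pos (u i.-1) < i by rewrite q prednK.
  split; last by right.
  - by apply: contraTneq qn => ->; rewrite ltnn.
  - by apply: contraTneq qn => ->; rewrite -E ltnn.
  - by move=> Eu; move: qn; rewrite Eu spine_pos_nth // ltnn.
  - by rewrite sedge_sym; have := spine_edge ip; rewrite prednK // => ->; rewrite orbT.
have w2P : [/\ w2 != val l, w2 != val l', w2 = u i -> leaf w2,
    (w2 == u i) || (u i -- w2) & w2 = val l2 \/ i < spine_pos w2].
  rewrite /w2; have [E1|E1] := eqVneq (spine_pos (val l2)) i.
    split; [by rewrite eq_sym dab|exact: valN|
      by move=> _; exact: (valP l2)|exact: spine_nbr|by left].
  have ip : i < size p by rewrite -ltnS (leq_trans _ p2s) // ltnS ltn_neqAle eq_sym E1.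
  have q := spine_pos_nth (ip : i.+1 < (size p).+1).
  have qn : i < spine_pos (u i.+1) by rewrite q.
  split; last by right.
  - by apply: contraTneq qn => ->; rewrite ltnn.
  - by apply: contraTneq qn => ->; rewrite -E ltnn.
  - by move=> Eu; move: qn; rewrite Eu spine_pos_nth // ltnn.
  - by rewrite spine_edge // orbT.
have [w1l w1l' w1f w1n w1c] := w1P; have [w2l w2l' w2f w2n w2c] := w2P.
have w12 : w1 != w2.
  apply/eqP => Ew; case: w1c => h1; case: w2c => h2.
  - by have := dab _ _ l1a l2b; rewrite -h1 -h2 Ew eqxx.
  - by move: h2; rewrite -Ew h1 ltnNge p1.
  - by move: h1; rewrite Ew h2 ltnNge p2.
  - by move: h1; rewrite Ew ltnNge ltnW.
apply: (@no_four i [:: val l; val l'; w1; w2]) => //.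
- rewrite /= !inE !negb_or (dab _ _ la lb) w12.
  by rewrite ![val l == _]eq_sym ![val l' == _]eq_sym w1l w1l' w2l w2l'.
- move=> v; rewrite !inE => /or4P[]/eqP-> //; move=> _; [exact: (valP l)|exact: (valP l')].
- move=> v; rewrite !inE => /or4P[]/eqP-> //; exact: spine_nbr.
Qed.

End Caterpillar.

(** The vertices are ordered by the positions of their leaves. A cut with at most one vertex on a
    side is thin; at any other cut the position increases strictly, so it is induced by a spine
    edge. *)
Lemma decomp_layout (G : sgraph) (D : lin_rank_decomp G) :
  ld_width D <= 1 -> has_layout G.
Proof.
move=> wD; have [treeT [x [p [pp up dom]]]] := ld_caterpillar D.
pose pos (l : {v : ld_tree D | leaf v}) := spine_pos x p (val l).
pose leT l l' := pos l <= pos l'.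
have leT_total : total leT by move=> l l'; exact: leq_total.
have leT_trans : transitive leT by move=> l l' l''; exact: leq_trans.
pose sl := sort leT (enum {: {v : ld_tree D | leaf v}}).
have usl : uniq sl by rewrite sort_uniq enum_uniq.
have inj : injective (@ld_map _ D) by apply: bij_inj; exact: ld_bij.
exists (map (@ld_map _ D) sl); split.
- by rewrite map_inj_uniq.
- move=> y; rewrite inE; have [g _ gK] := ld_bij D.
  by rewrite -(gK y) map_f // mem_sort mem_enum.
move=> s1 s2 es; pose k := size s1.
have esl : sl = take k sl ++ drop k sl by rewrite cat_take_drop.
have e1 : s1 = map (@ld_map _ D) (take k sl) by rewrite map_take es take_size_cat.
have e2 : s2 = map (@ld_map _ D) (drop k sl) by rewrite map_drop es drop_size_cat.
move: (take k sl) (drop k sl) esl e1 e2 => a b esl {es k}-> ->.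
have uab : uniq (a ++ b) by rewrite -esl.
have ord : {in a & b, forall l l', pos l <= pos l'}.
  have : sorted leT (a ++ b) by rewrite -esl sort_sorted.
  rewrite (sorted_pairwise leT_trans) pairwise_cat => /and3P[/allrelP h _ _].
  by move=> l l' la lb; exact: h.
have [a1|a1] := leqP (size a) 1.
  case: a a1 {uab ord esl} => [|l [|//]] _.
    by move=> q q' r r' /=; rewrite in_nil.
  by apply: (@thin1 _ _ _ _ (ld_map l)) => y; rewrite inE => /eqP.
have [b1|b1] := leqP (size b) 1.
  case: b b1 {uab ord esl} => [|l [|//]] _.
    by move=> q q' r r' /= _ _; rewrite in_nil.
  apply: thinC; first by split; [exact: sedge_sym|exact: sedge_irr].
  by apply: (@thin1 _ _ _ _ (ld_map l)) => y; rewrite inE => /eqP.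
have lt : {in a & b, forall l l', pos l < pos l'}.
  move=> l l' la lb; rewrite ltn_neqAle ord // andbT.
  exact: (crowded_spine pp up dom (@ld_degree _ D) uab ord a1 b1 la lb).
(* The last position on the left; the spine edge from [i] to [i.+1] induces the cut. *)
pose i := \max_(l <- a) pos l.
have ia l : l \in a -> pos l <= i by move=> la; apply: leq_bigmax_seq.
have ib l : l \in b -> i < pos l.
  move=> lb; have [l0 l0a] : exists l0, l0 \in a.
    by case: a a1 {uab ord esl lt i ia} => // l0 ? _; exists l0; rewrite mem_head.
  have pl : 0 < pos l by apply: leq_ltn_trans (lt _ _ l0a lb).
  by rewrite -(prednK pl) ltnS; apply/bigmax_leqP_seq => l1 l1a _;
    rewrite -ltnS prednK // lt.
have ip : i < size p.
  case: b b1 ib {uab ord esl lt} => // l0 b _ /(_ l0 (mem_head _ _)) h.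
  by have [h' _] := spine_posP dom (val l0); rewrite -ltnS; apply: leq_ltn_trans h'.
have side := leaf_side_spine treeT pp up dom _ ip.
have ed := spine_edge pp ip.
set X := [set ld_map l | l in leaf_side (nth x (x :: p) i) (nth x (x :: p) i.+1)].
have : cutrk X <= 1.
  apply: leq_trans wD.
  exact: (@leq_bigmax_cond _ (fun e : ld_tree D * ld_tree D => e.1 -- e.2)
    (fun e => cutrk [set ld_map l | l in leaf_side e.1 e.2])
    (nth x (x :: p) i, nth x (x :: p) i.+1)).
move/cutrk_le1P; apply: thinS => y /mapP[l hl ->] /=.
  by rewrite mem_imset // side ia.
by rewrite inE mem_imset // side -ltnNge ib.
Qed.

(** * From layouts to decompositions *)

(** The highest vertex of a cycle would have two distinct neighbours below it. *)
Lemma acyclic_of_height (T : sgraph) (h : T -> nat) : injective h ->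
  (forall v a b : T, v -- a -> v -- b -> h a <= h v -> h b <= h v -> a = b) ->
  forall c : seq T, 2 < size c -> ~ ucycle (@sedge T) c.
Proof.
move=> hi low c sc uc.
have [v0 v0c] : exists v, v \in c.
  by case: c sc {uc} => // v ? _; exists v; rewrite mem_head.
have [v vc vmax] : exists2 v, v \in c & forall w, w \in c -> h w <= h v.
  case: (arg_maxnP (fun v => h v) (v0c : [pred v in c] v0)) => v vc vm.
  by exists v.
have [i q eq] := rot_to vc.
have : ucycle (@sedge T) (v :: q) by rewrite -eq rot_ucycle.
have {sc} : 2 < size (v :: q) by rewrite -eq size_rot.
have {}vmax w : w \in v :: q -> h w <= h v by rewrite -eq mem_rot; exact: vmax.
case: q {eq} vmax => [|y q] // vmax; case/lastP: q vmax => [|q z] // vmax _.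
rewrite /ucycle /ucycleb /= rcons_path last_rcons => /and4P[/andP[vy /andP[_ zv]] _ yq _].
have E : y = z.
  apply: (low v) => //; first by rewrite sedge_sym.
    by apply: vmax; rewrite !inE eqxx orbT.
  by apply: vmax; rewrite !inE mem_rcons mem_head !orbT.
by move: yq; rewrite E mem_rcons mem_head.
Qed.

(** A vertex connected to [x] stays connected to [x] or to [y] after the cut, and [S] is constant
    along the remaining edges. *)
Lemma cut_edge_side (T : sgraph) (x y v : T) (S : pred T) :
  connect (@sedge T) x v -> S x -> ~~ S y ->
  (forall u w, cut_edge x y u w -> S u = S w) ->
  connect (cut_edge x y) x v = S v.
Proof.
move=> xv Sx Sy cl.
have inv a b : connect (cut_edge x y) a b -> S a = S b.
  case/connectP => p + ->; elim: p a => //= c p IH a /andP[/cl-> /IH].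
  by [].
have reach a p : path (@sedge T) a p ->
    connect (cut_edge x y) x a || connect (cut_edge x y) y a ->
    connect (cut_edge x y) x (last a p) || connect (cut_edge x y) y (last a p).
  elim: p a => //= c p IH a /andP[ac pp] ha; apply: (IH c pp).
  have [E|nE] := eqVneq [set a; c] [set x; y].
    have : c \in [set x; y] by rewrite -E set22.
    by rewrite !inE => /orP[]/eqP->; rewrite connect0 ?orbT.
  have ac' : connect (cut_edge x y) a c by apply: connect1; rewrite /cut_edge /= ac.
  by case/orP: ha => /connect_trans/(_ ac')->; rewrite ?orbT.
have {}reach : connect (cut_edge x y) x v || connect (cut_edge x y) y v.
  by case/connectP: xv => p pp ->; apply: reach pp _; rewrite connect0.
apply/idP/idP => [/inv<-//|Sv]; case/orP: reach => // /inv E.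
by rewrite E Sv in Sy.
Qed.

Section CombTree.
Variable m : nat.

(* A spine with [m + 2] vertices, whose ends are leaves, and one pendant leaf
   [inr j] at each inner spine vertex [inl j.+1]. *)
Definition comb_edge : rel ('I_m.+2 + 'I_m) := fun x y =>
  match x, y with
  | inl i, inl j => (i.+1 == j :> nat) || (j.+1 == i :> nat)
  | inl i, inr j | inr j, inl i => i == j.+1 :> nat
  | inr _, inr _ => false
  end.

Lemma comb_edge_sym : symmetric comb_edge.
Proof. by move=> [i|i] [j|j] //=; rewrite orbC. Qed.

Lemma comb_edge_irr : irreflexive comb_edge.
Proof. by move=> [i|i] //=; rewrite gtn_eqF. Qed.

Definition comb : sgraph := SGraph comb_edge_sym comb_edge_irr.

Definition spine i : comb := inl (inord i).

Lemma spine_inl (i : 'I_m.+2) : inl i = spine i.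
Proof. by rewrite /spine inord_val. Qed.

Lemma spine_edgeE i j : i < m.+2 -> j < m.+2 ->
  (spine i -- spine j) = (i.+1 == j) || (j.+1 == i).
Proof. by move=> im jm; rewrite /= !inordK. Qed.

Lemma comb_path : path (@sedge comb) (spine 0) (map spine (iota 1 m.+1)).
Proof.
apply/(pathP (spine 0)) => i; rewrite size_map size_iota => im; have im' : i < m.+2 by exact: ltnW.
rewrite -[_ :: _]/(map spine (iota 0 m.+2)) !(nth_map 0) ?size_iota ?nth_iota //.
by rewrite spine_edgeE ?eqxx.
Qed.

Lemma comb_connect v : connect (@sedge comb) (spine 0) v.
Proof.
have sp i : i < m.+2 -> connect (@sedge comb) (spine 0) (spine i).
  elim: i => [|i IH] im; first exact: connect0.
  apply: connect_trans (IH (ltnW im)) (connect1 _).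
  by rewrite spine_edgeE ?eqxx // ltnW.
case: v => [i|j]; first by rewrite spine_inl; apply: sp.
have jm : j.+1 < m.+2 by rewrite !ltnS ltnW.
by apply: connect_trans (sp _ jm) (connect1 _); rewrite /= inordK.
Qed.

(** A pendant leaf stands just above its spine vertex and below the next one, so each vertex has at
    most one lower neighbour. *)
Definition comb_height (v : comb) :=
  match v with inl i => i.*2 | inr j => j.+1.*2.+1 end.

Lemma comb_tree : is_tree comb.
Proof.
split; first by apply/card_gt0P; exists (spine 0).
  move=> x y; apply: connect_trans (comb_connect y).
  by rewrite (sym_connect_sym (@sedge_sym comb)); exact: comb_connect.
apply: (@acyclic_of_height comb comb_height).
  move=> [i|i] [j|j] /= E; first by congr inl; apply: ord_inj; lia.
  - by exfalso; lia.
  - by exfalso; lia.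
  - by congr inr; apply: ord_inj; lia.
move=> [v|v] [a|a] [b|b] //=; try by [move=> *; exfalso; lia];
  by move=> *; congr inl; apply: ord_inj; lia.
Qed.

Lemma comb_caterpillar : caterpillar comb.
Proof.
split; first exact: comb_tree.
exists (spine 0), (map spine (iota 1 m.+1)); split; first exact: comb_path.
  rewrite -[_ :: _]/(map spine (iota 0 m.+2)) map_inj_in_uniq ?iota_uniq //.
  move=> i j; rewrite !mem_iota /= => im jm [] /(congr1 val) /=.
  by rewrite !inordK.
rewrite -[_ :: _]/(map spine (iota 0 m.+2)) => -[i|j].
  exists (spine i); first by rewrite map_f // mem_iota ltn_ord.
  by rewrite spine_inl eqxx.
exists (spine j.+1); first by rewrite map_f // mem_iota /= !ltnS ltnW.
by rewrite /= inordK ?eqxx ?orbT // !ltnS ltnW.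
Qed.

Lemma comb_card : 1 < #|comb|.
Proof. by rewrite card_sum !card_ord. Qed.

Lemma comb_degree_end (i : 'I_m.+2) : i = 0 :> nat \/ i = m.+1 :> nat ->
  degree (inl i : comb) = 1.
Proof.
move=> h; rewrite /degree.
have -> : [set y | (inl i : comb) -- y] = [set spine (if i == 0 :> nat then 1 else m)].
  apply/setP => -[j|j]; rewrite !inE /=; have := ltn_ord j; last first.
    by move=> jm; apply/negbTE/eqP => E; lia.
  move=> jm; rewrite spine_inl /spine; apply/idP/eqP => [E|[] /(congr1 val) /=].
    by congr (inl (inord _)); case: eqP; lia.
  by rewrite !inordK //; case: eqP; lia.
by rewrite cards1.
Qed.

Lemma comb_degree_pendant (j : 'I_m) : degree (inr j : comb) = 1.
Proof.
rewrite /degree.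
have -> : [set y | (inr j : comb) -- y] = [set spine j.+1].
  apply/setP => -[i|i]; rewrite !inE //=; have := ltn_ord j => jm.
  rewrite spine_inl /spine; apply/idP/eqP => [/eqP->//|[] /(congr1 val) /=].
  by rewrite !inordK //; lia.
by rewrite cards1.
Qed.

Lemma comb_degree_inner (i : 'I_m.+2) : i != 0 :> nat -> i != m.+1 :> nat ->
  degree (inl i : comb) = 3.
Proof.
move=> i0 im; have im2 := ltn_ord i; rewrite /degree.
have jm : i.-1 < m by lia.
have -> : [set y | (inl i : comb) -- y] =
    [set spine i.-1; spine i.+1; inr (Ordinal jm)].
  apply/setP => -[j|j]; rewrite !inE /=.
    rewrite spine_inl /spine orbF.
    rewrite ![inl _ == _](inj_eq (@inl_inj _ _)) -!val_eqE /= !inordK //; lia.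
  by rewrite [inr _ == _](inj_eq (@inr_inj _ _)) -val_eqE /=; lia.
rewrite setUC cardsU1 cards2 !inE /=.
rewrite ![inl _ == _](inj_eq (@inl_inj _ _)) -val_eqE /= !inordK ?ltnS //; try lia.
Qed.

Lemma comb_leafE (v : comb) : leaf v =
  match v with inl i => (i == 0 :> nat) || (i == m.+1 :> nat) | inr _ => true end.
Proof.
rewrite /leaf; case: v => [i|j]; last by rewrite comb_degree_pendant.
have [i0|i0] := eqVneq (i : nat) 0; first by rewrite comb_degree_end //; left.
have [im|im] := eqVneq (i : nat) m.+1; first by rewrite comb_degree_end //; right.
by rewrite comb_degree_inner.
Qed.

Lemma comb_degree (v : comb) : ~~ leaf v -> degree v = 3.
Proof.
rewrite comb_leafE; case: v => // i; rewrite negb_or => /andP[].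
exact: comb_degree_inner.
Qed.

Definition comb_pos (v : comb) : nat :=
  match v with inl i => i | inr j => j.+1 end.

Lemma comb_pos_lt v : comb_pos v < m.+2.
Proof. by case: v => [i|j] //=; rewrite !ltnS ltnW. Qed.

(** The end positions belong to the ends of the spine, the inner ones to pendant leaves. The last
    [spine i] is a default, reached only for [i] at least [m.+2]. *)
Definition comb_leaf (i : nat) : comb :=
  if (i == 0) || (i == m.+1) then spine i else
  if insub i.-1 is Some j then inr j else spine i.

Lemma comb_leafP i : i < m.+2 -> leaf (comb_leaf i) /\ comb_pos (comb_leaf i) = i.
Proof.
move=> im; rewrite comb_leafE /comb_leaf; case: ifPn => [h|].
  by rewrite /= !inordK.
rewrite negb_or => /andP[i0 i1]; have jm : i.-1 < m by lia.
by rewrite insubT /= prednK // lt0n.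
Qed.

Lemma comb_leaf_inj (u v : comb) : leaf u -> leaf v -> comb_pos u = comb_pos v -> u = v.
Proof.
rewrite !comb_leafE; case: u v => [i|i] [j|j] //= hi hj E.
- by congr inl; apply: ord_inj.
- by have := ltn_ord j; lia.
- by have := ltn_ord i; lia.
- by congr inr; apply: ord_inj; case: E.
Qed.

(** A spine edge cuts the leaf order into two segments, and a pendant edge splits off one leaf; the
    two orientations of each give the four cases. *)
Lemma comb_leaf_side x y : x -- y ->
  (exists i, forall l, (l \in leaf_side x y) = (comb_pos (val l) <= i)) \/
  (exists i, forall l, (l \in leaf_side x y) = (i < comb_pos (val l))) \/
  (exists i, forall l, (l \in leaf_side x y) = (comb_pos (val l) == i)) \/
  (exists i, forall l, (l \in leaf_side x y) = (comb_pos (val l) != i)).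
Proof.
have cc (u v : comb) : connect (@sedge comb) u v.
  by have [_ h _] := comb_tree; exact: h.
have main (a b : comb) (S : pred comb) : S a -> ~~ S b ->
    (forall u w, cut_edge a b u w -> S u = S w) ->
    (forall l, (l \in leaf_side a b) = S (val l)) /\
    (forall l, (l \in leaf_side b a) = ~~ S (val l)).
  move=> Sa Sb cl; split=> l; rewrite inE.
    exact: (cut_edge_side (cc _ _)).
  apply: (@cut_edge_side _ b a _ (predC S)) => //=; first by rewrite Sa.
  by move=> u w; rewrite /cut_edge /= [[set b; a]]setUC => /cl->.
have seg (i j : 'I_m.+2) : i.+1 = j :> nat ->
    (forall l, (l \in leaf_side (inl i : comb) (inl j)) = (comb_pos (val l) <= i)) /\
    (forall l, (l \in leaf_side (inl j : comb) (inl i)) = ~~ (comb_pos (val l) <= i)).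
  move=> ij; apply: (main _ _ (fun v => comb_pos v <= i)) => /=.
  - exact: leqnn.
  - by rewrite -ij ltnn.
  have ne (k k' : 'I_m.+2) : k.+1 = k' :> nat ->
      [set (inl k : comb); inl k'] != [set inl i; inl j] -> (k <= i) = (k' <= i).
    move=> kk' ne; have ki : k != i :> nat.
      apply: contra_neq ne => ki; have -> : k = i by exact: ord_inj.
      by have -> : k' = j by apply: ord_inj; rewrite -kk' -ij ki.
    by rewrite -kk'; lia.
  move=> [k|k] [k'|k'] /andP[/=] //.
  - case/orP=> /eqP h; first exact: ne.
    by rewrite setUC => /(ne _ _ h)->.
  - by move=> /eqP->.
  - by move=> /eqP->.
have pend (j : 'I_m) (i : 'I_m.+2) : i = j.+1 :> nat ->
    (forall l, (l \in leaf_side (inr j : comb) (inl i)) = (val l == inr j)) /\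
    (forall l, (l \in leaf_side (inl i : comb) (inr j)) = (val l != inr j)).
  move=> ij; apply: (main _ _ (fun v => v == inr j)) => //=.
  have no (w : comb) : (inr j : comb) -- w ->
      [set (inr j : comb); w] != [set inr j; inl i] -> False.
    case: w => // k /eqP kj; case/eqP; have -> // : k = i.
    by apply: ord_inj; rewrite kj ij.
  move=> u w /andP[uw ne]; apply/eqP/eqP => E; subst.
    by case: (no w).
  by case: (no u); rewrite // 1?sedge_sym // setUC.
have eq_pendant (l : {v : comb | leaf v}) (j : 'I_m) :
    (val l == inr j) = (comb_pos (val l) == j.+1).
  apply/eqP/eqP => [->//|E]; apply: comb_leaf_inj => //; first exact: (valP l).
  by rewrite comb_leafE.
case: x y => [i|i] [j|j] //=.
- case/orP=> /eqP /seg[h1 h2]; [left|right; left].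
    by exists i.
  by exists j => l; rewrite h2 ltnNge.
- move=> /eqP /pend[_ h]; right; right; right; exists j.+1 => l.
  by rewrite h eq_pendant.
- move=> /eqP /pend[h _]; right; right; left; exists i.+1 => l.
  by rewrite h eq_pendant.
Qed.

End CombTree.

(** The layout is placed on the leaves of a comb from left to right. Spine edges then induce cuts of
    the layout, and pendant edges cut off single vertices. *)
Lemma layout_decomp (G : sgraph) : has_layout G -> 1 < #|G| ->
  exists D : lin_rank_decomp G, ld_width D <= 1.
Proof.
move=> [s [us ms hs]] G1.
have sG : size s = #|G| by rewrite -(card_uniqP us); apply: eq_card => x; rewrite ms inE.
have [m sm] : exists m, size s = m.+2.
  by move: G1; rewrite -sG; case: (size s) => [|[|m]] // _; exists m.
have [x0 _] : exists x : G, x \in G.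
  by apply/card_gt0P; apply: ltn_trans G1.
have sin x : x \in s by rewrite ms inE.
pose f (l : {v : comb m | leaf v}) : G := nth x0 s (comb_pos (val l)).
have ilt x : index x s < m.+2 by rewrite -sm index_mem.
pose g (x : G) : {v : comb m | leaf v} :=
  exist _ (comb_leaf m (index x s)) (proj1 (comb_leafP (ilt x))).
have gK : cancel g f.
  by move=> x; rewrite /f /= (proj2 (comb_leafP (ilt x))) nth_index.
have fidx l : index (f l) s = comb_pos (val l).
  by rewrite /f index_uniq // sm; exact: comb_pos_lt.
have fK : cancel f g.
  move=> l; apply: val_inj => /=; rewrite fidx.
  have [h1 h2] := comb_leafP (comb_pos_lt (val l)).
  by apply: comb_leaf_inj => //; exact: (valP l).
exists (LinRankDecomp (comb_caterpillar m) (comb_card m) (@comb_degree m)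
  (Bijective fK gK)).
apply/bigmax_leqP => -[x y] /= xy; apply/cutrk_le1P.
have ge : graph_rel (@sedge G) by split; [exact: sedge_sym|exact: sedge_irr].
have mem (z : G) (S : {set _}) : (z \in [set f l | l in S]) = (g z \in S).
  by rewrite -{1}(gK z) mem_imset //; exact: can_inj fK.
have posg z : comb_pos (val (g z)) = index z s by rewrite -fidx gK.
have seg i : thin (@sedge G) [pred z | index z s <= i] [pred z | i < index z s].
  have := hs (take i.+1 s) (drop i.+1 s); rewrite cat_take_drop => /(_ erefl).
  apply: thinS => z /=; rewrite inE => h; first by rewrite in_take // sin.
  have := sin z; rewrite -{1}(cat_take_drop i.+1 s) mem_cat in_take //.
  by rewrite ltnS leqNgt h.
have single i : thin (@sedge G) [pred z | index z s == i] [pred z | index z s != i].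
  apply: (@thin1 _ _ _ _ (nth x0 s i)) => z; rewrite inE => /eqP<-.
  by rewrite nth_index.
have [[i h]|[[i h]|[[i h]|[i h]]]] := comb_leaf_side xy.
- by apply: thinS (seg i) => z; rewrite !inE mem h posg // -ltnNge.
- by apply: thinS (thinC ge (seg i)) => z; rewrite !inE mem h posg // -leqNgt.
- by apply: thinS (single i) => z; rewrite !inE mem h posg.
- by apply: thinS (thinC ge (single i)) => z; rewrite !inE mem h posg // negbK.
Qed.

(** * Linear rankwidth at most 1 *)

Lemma linear_rankwidth_le1P (G : sgraph) :
  linear_rankwidth G <= 1 <-> has_layout G.
Proof.
rewrite /linear_rankwidth; have [G1|G1] := leqP #|G| 1.
  by split=> // _; apply: layout_small; rewrite cardsT (leq_trans G1).
set P := (X in classical_sets.xget _ X); split=> [|lG].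
  have [exP|nP] := pselect (exists k, P k).
    have [[D DK] _] : P (classical_sets.xget #|G| P) by exact: classical_sets.xgetPex exP.
    by rewrite -DK; exact: decomp_layout.
  (* Without a minimum the value would be the default [#|G|], which exceeds 1. *)
  rewrite classical_sets.xgetPN; first by rewrite leqNgt G1.
  by move=> k Pk; apply: nP; exists k.
have [D wD] := layout_decomp lG G1.
have exP : exists k, P k.
  (* The minimum exists because some decomposition does and widths are natural numbers. *)
  have ex : exists k, `[< exists D : lin_rank_decomp G, ld_width D = k >].
    by exists (ld_width D); apply/asboolP; exists D.
  have [k /asboolP hk kmin] := ex_minnP ex; exists k; split=> // D'.
  by apply: kmin; apply/asboolP; exists D'.
have [_ min] := classical_sets.xgetPex #|G| exP.
exact: leq_trans (min D) wD.
Qed.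

Theorem theorem1 (G : sgraph) :
  linear_rankwidth G <= 1 <->
  [/\ ~ vertex_minor C5 G, ~ vertex_minor net G & ~ vertex_minor half_cube G].
Proof.
exact: iff_trans (linear_rankwidth_le1P G) (layout_vertex_minor G).
Qed.
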